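(* Let $F=f+\psi-g$ on $\mathbb{R}^n$ satisfy the standing assumptions (A1)–(A4) listed in the context, with positive integers $p,q$, and let $(x_k)_{k\ge0}$ be a sequence generated by the HO-DC algorithm (defined in the context). Assume also that $F$ is semi-algebraic (i.e., it satisfies the semi-algebraic Kurdyka-Lojasiewicz condition stated in the context for some $r>1$). Then the whole sequence $(x_k)_{k\ge0}$ converges to a stationary point $x^*$ of $F$ (i.e. $0\in\partial F(x^* )$), with the following rates: (i) If $(r-1)\min(p,q)<1$, the convergence is sublinear. (ii) If $(r-1)\min(p,q)\ge1$, the convergence is linear.
   Context: Problem: minimize $F(x)=f(x)+\psi(x)-g(x)$ over $x\in\mathbb{R}^n$ (Euclidean norm $\|\cdot\|$), where $\text{dom}\,F=\text{dom}\,\psi$. Standing assumptions, with $p,q$ positive integers: (A1) $f$ is convex and $p$ times continuously differentiable on the closed convex set $\text{dom}\,\psi$, and its $p$-th derivative is Lipschitz continuous there with constant $L_p^f>0$: $\|D^pf(x)-D^pf(y)\|\le L_p^f\|x-y\|$ for all $x,y\in\text{dom}\,\psi$. (A2) $g$ is convex and $q$ times continuously differentiable on $\text{dom}\,\psi$, and its $q$-th derivative is Lipschitz continuous there with constant $L_q^g>0$. (A3) $\psi$ is proper, lower semicontinuous, convex (possibly nondifferentiable), and simple (meaning that its presence in the model below does not add computational difficulty in minimizing the model). (A4) The problem has a solution, and hence $\inf_{x\in\text{dom}\,\psi}F(x)\ge F^*>-\infty$. The norm of a symmetric $p$-linear form is $\|D^p\phi(x)\|=\max\{|D^p\phi(x)[h]^p|:\|h\|\le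 1\}$, where $D^p\phi(x)[h]^p$ denotes evaluation with all arguments equal to $h$. Taylor approximation: $T_p^{\phi}(y;x)=\phi(x)+\sum_{i=1}^p\frac1{i!}D^i\phi(x)[y-x]^i$. Model: for constants $M_p>L_p^f$, $M_q>L_q^g$ (two separate constants, even if $p=q$), $$m_p^q(y;x)=T_p^f(y;x)+\frac{M_p}{(p+1)!}\|y-x\|^{p+1}+\psi(y)-T_q^g(y;x)+\frac{M_q}{(q+1)!}\|y-x\|^{q+1}.$$ HO-DC algorithm: choose $x_0\in\text{dom}\,\psi$, $M_p>L_p^f$, $M_q>L_q^g$. For each $k\ge 0$, compute $x_{k+1}$ a stationary point of $\min_y m_p^q(y;x_k)$, i.e. $0\in\partial m_p^q(x_{k+1};x_k)$ (subdifferential in the first argument), satisfying $m_p^q(x_{k+1};x_k)\le m_p^q(x_k;x_k)=F(x_k)$. Here $\partial$ is the limiting (Mordukhovich) subdifferential, and $S_F(x)=\text{dist}(0,\partial F(x))$. Semi-algebraic Kurdyka-Lojasiewicz (KL) condition with exponent $r>1$: for a compact connected set $\Omega\subseteq\text{dom}\,F$ on which $F$ takes a constant value $F_*$, there exist $\sigma_r>0$ and $\delta,\epsilon>0$ such that $$F(x)-F_*\le\sigma_r\,S_F(x)^r\quad\text{for all }x\text{ with }\text{dist}(x,\Omega)\le\delta,\ F_*<F(x)<F_*+\epsilon.$$ The set $\Omega$ of interest is the set of limit points of $(x_k)_{k\ge0}$. Semi-algebraic functions satisfy such a condition for some $r>1$. Rates: convergence $x_k\to x^*$ is linear if there exist $c>0$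 and $\tau\in(0,1)$ with $\|x_k-x^*\|\le c\,\tau^k$ for all sufficiently large $k$, and sublinear if there exist $c>0$ and $\alpha>0$ with $\|x_k-x^*\|\le c\,k^{-\alpha}$ for all sufficiently large $k$.
   Formalization: The set of limit points of the sequence is additionally assumed nonempty and compact; otherwise the claim fails (F = x²/(1+x⁴), f = F + Lx²/2, g = Lx²/2, p = q = 1, start x_0 > 1: the iterates go to infinity). *)

(* Defs.v *)
From HB Require Import structures.
From mathcomp Require Import all_boot all_order all_algebra.
From mathcomp Require Import all_classical all_reals all_analysis.
Set Implicit Arguments.
Unset Strict Implicit.
Unset Printing Implicit Defensive.
Import Order.TTheory GRing.Theory Num.Theory.
Import numFieldNormedType.Exports.
Local Open Scope classical_set_scope.
Local Open Scope ring_scope.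

(* The library norm `|x| on 'rV[R]_n is the sup norm.  It is used only through
   the topology and differentiability, which do not depend on the choice of a
   norm; all quantitative statements use the Euclidean norm enorm. *)

Definition dotp (R : realType) (n : nat) (u v : 'rV[R]_n) : R :=
  \sum_(i < n) u ord0 i * v ord0 i.

Definition enorm (R : realType) (n : nat) (u : 'rV[R]_n) : R :=
  Num.sqrt (dotp u u).

(* Infimum in \bar R, so that the distance to the empty set is +oo. *)
Definition edist (R : realType) (n : nat) (x : 'rV[R]_n)
    (A : set 'rV[R]_n) : \bar R :=
  ereal_inf [set (enorm (x - y))%:E | y in A].

Definition dom (R : realType) (n : nat) (F : 'rV[R]_n -> \bar R) :
    set 'rV[R]_n :=
  [set x | (F x < +oo)%E].

Definition proper_efun (R : realType) (n : nat) (F : 'rV[R]_n -> \bar R) : Prop :=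
  (forall x, F x != -oo%E) /\ dom F !=set0.

(* The library's convex_function only covers finite-valued functions. *)
Definition econvex (R : realType) (n : nat) (F : 'rV[R]_n -> \bar R) : Prop :=
  forall (x y : 'rV[R]_n) (t : R), 0 <= t <= 1 ->
    (F (t *: x + (1 - t) *: y)%R <= t%:E * F x + (1 - t)%:E * F y)%E.

(* phi is k times continuously differentiable on U (meant for U open): in
   finite dimension x |-> 'd phi x is C^k as soon as each x |-> 'd phi x h is. *)
Fixpoint Ck (R : realType) (n : nat) (U : set 'rV[R]_n) (k : nat)
    (phi : 'rV[R]_n -> R) : Prop :=
  match k with
  | 0 => forall x, U x -> {for x, continuous phi}
  | k'.+1 => (forall x, U x -> differentiable phi x) /\
             (forall h : 'rV[R]_n, Ck U k' (fun x => 'd phi x h))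
  end.

(* Being C^k on a (closed) set D means being C^k on an open neighbourhood of
   D, so that the derivatives make sense at boundary points of D. *)
Definition Ck_on (R : realType) (n : nat) (D : set 'rV[R]_n) (k : nat)
    (phi : 'rV[R]_n -> R) : Prop :=
  exists2 U : set 'rV[R]_n, open U /\ D `<=` U & Ck U k phi.

(* D^i phi(x)[h]^i *)
Definition Dpow (R : realType) (n : nat) (i : nat) (phi : 'rV[R]_n -> R)
    (x h : 'rV[R]_n) : R :=
  iter i (fun (chi : 'rV[R]_n -> R) y => 'd chi y h) phi x.

(* Norm of the symmetric multilinear form A given by Q h = A[h]^p. *)
Definition symnorm (R : realType) (n : nat) (Q : 'rV[R]_n -> R) : \bar R :=
  ereal_sup [set `|Q h|%:E | h in [set h | enorm h <= 1]].

Definition lipschitz_D (R : realType) (n : nat) (D : set 'rV[R]_n) (p : nat)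
    (phi : 'rV[R]_n -> R) (L : R) : Prop :=
  forall x y, D x -> D y ->
    (symnorm (fun h => Dpow p phi x h - Dpow p phi y h)%R
       <= (L * enorm (x - y))%:E)%E.

Definition taylor (R : realType) (n : nat) (p : nat) (phi : 'rV[R]_n -> R)
    (y x : 'rV[R]_n) : R :=
  phi x + \sum_(1 <= i < p.+1) (i`!%:R)^-1 * Dpow i phi x (y - x).

Definition objective (R : realType) (n : nat) (f : 'rV[R]_n -> R)
    (psi : 'rV[R]_n -> \bar R) (g : 'rV[R]_n -> R) (x : 'rV[R]_n) : \bar R :=
  ((f x)%:E + psi x - (g x)%:E)%E.

Definition model (R : realType) (n p q : nat) (f : 'rV[R]_n -> R)
    (psi : 'rV[R]_n -> \bar R) (g : 'rV[R]_n -> R) (Mp Mq : R)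
    (y x : 'rV[R]_n) : \bar R :=
  ((taylor p f y x + Mp / (p.+1)`!%:R * enorm (y - x) ^+ p.+1)%:E
   + psi y
   + (- taylor q g y x + Mq / (q.+1)`!%:R * enorm (y - x) ^+ q.+1)%:E)%E.

Definition frechet_subdiff (R : realType) (n : nat) (F : 'rV[R]_n -> \bar R)
    (x : 'rV[R]_n) : set 'rV[R]_n :=
  [set v | F x \is a fin_num /\
     (0 <= limf_einf
        (fun y : 'rV[R]_n =>
           (F y - F x - (dotp v (y - x))%:E) * ((enorm (y - x))^-1)%:E)
        x^')%E].

(* Limiting (Mordukhovich) subdifferential. *)
Definition limiting_subdiff (R : realType) (n : nat)
    (F : 'rV[R]_n -> \bar R) (x : 'rV[R]_n) : set 'rV[R]_n :=
  [set v | F x \is a fin_num /\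
     exists (u w : nat -> 'rV[R]_n),
       [/\ u @ \oo --> x,
           F \o u @ \oo --> F x,
           w @ \oo --> v &
           forall k, frechet_subdiff F (u k) (w k)]].

(* S_F(x), equal to +oo when the subdifferential is empty. *)
Definition stat_measure (R : realType) (n : nat) (F : 'rV[R]_n -> \bar R)
    (x : 'rV[R]_n) : \bar R :=
  edist 0 (limiting_subdiff F x).

Definition limit_points (R : realType) (n : nat) (x : nat -> 'rV[R]_n) :
    set 'rV[R]_n :=
  cluster (x @ \oo).

Definition KL_condition (R : realType) (n : nat) (F : 'rV[R]_n -> \bar R)
    (r : R) (Omega : set 'rV[R]_n) : Prop :=
  forall Fs : R,
    compact Omega -> connected Omega -> Omega `<=` dom F ->
    (forall x, Omega x -> F x = Fs%:E) ->
    exists sigma delta eps : R,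
      [/\ 0 < sigma, 0 < delta, 0 < eps &
       forall x : 'rV[R]_n,
         (edist x Omega <= delta%:E)%E ->
         (Fs%:E < F x)%E -> (F x < (Fs + eps)%:E)%E ->
         (F x - Fs%:E <= sigma%:E * poweR (stat_measure F x) r)%E].

Definition HO_DC (R : realType) (n p q : nat) (f : 'rV[R]_n -> R)
    (psi : 'rV[R]_n -> \bar R) (g : 'rV[R]_n -> R) (Lpf Lqg Mp Mq : R)
    (x : nat -> 'rV[R]_n) : Prop :=
  [/\ Lpf < Mp, Lqg < Mq, dom psi (x 0%N) &
   forall k,
     limiting_subdiff (fun y => model p q f psi g Mp Mq y (x k)) (x k.+1) 0 /\
     (model p q f psi g Mp Mq (x k.+1) (x k)
        <= model p q f psi g Mp Mq (x k) (x k))%E].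

Definition linear_rate (R : realType) (n : nat) (x : nat -> 'rV[R]_n)
    (xs : 'rV[R]_n) : Prop :=
  exists c tau : R, [/\ 0 < c, 0 < tau < 1 &
    \forall k \near \oo, enorm (x k - xs) <= c * tau ^+ k].

Definition sublinear_rate (R : realType) (n : nat) (x : nat -> 'rV[R]_n)
    (xs : 'rV[R]_n) : Prop :=
  exists c alpha : R, [/\ 0 < c, 0 < alpha &
    \forall k \near \oo, enorm (x k - xs) <= c * (k%:R `^ (- alpha))].

(* Main.v *)
Require Import Defs.
From HB Require Import structures.
From mathcomp Require Import all_boot all_order all_algebra.
From mathcomp Require Import all_classical all_reals all_analysis.
From mathcomp Require Import ring lra.
Import Order.TTheory GRing.Theory Num.Theory.
Import numFieldNormedType.Exports.
Set Implicit Arguments.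
Unset Strict Implicit.
Local Open Scope classical_set_scope.
Local Open Scope ring_scope.

(** Put s = min(p,q) and d_k = |x_{k+1} - x_k|. Two estimates link the steps to the objective. (a)
    Taylor's formula with a Lipschitz top derivative makes the model majorize F, with a margin
    proportional to M_p - L_p^f and M_q - L_q^g; since each step does not increase the model, F(x_k)
    - F(x_{k+1}) >= c d_k^(s+1) ([objective_decrease]). (b) As psi is convex, stationarity of
    x_{k+1} says that minus the gradient of the smooth part of the model is a convex subgradient of
    psi there ([next_stationary]). Adding grad f - grad g gives a Frechet subgradient of F. Its norm
    is the error of the Taylor gradients plus the gradient of the regularization, hence O(d_k^p +
    d_k^q) ([small_subgradient]).

    By (a) the values decrease to a limit F_* and the steps tend to 0. Vanishing steps make the
    compact limit set connected and keep the iterates near it eventually ([limit_points_connected],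
    [limit_points_trap]), and F equals F_* on it ([limit_value]). So the KL inequality applies, and
    with A_k = F(x_k) - F_* and (b) it reads A_{k+1} <= C d_k^(s r) ([KL_descent]).

    The rest is about real sequences. Concavity of t^(1-1/r) gives d_k <= d_{k-1}/2 + K(phi_k -
    phi_{k+1}) with phi_k = A_k^(1-1/r). Hence E_k = d_{k-1} + 2K phi_k drops by at least d_k at
    each step and bounds the remaining length of the trajectory. Using KL again, E_{k+1} <= K' (E_k
    - E_{k+1})^theta with theta = min(1, (r-1)s) ([KL_energy]). This forces E_k = O(k^(-theta)) in
    general and geometric decay when theta = 1. *)

Lemma near_eq_differentiable (R : numFieldType) (V W : normedModType R)
    (phi chi : V -> W) (x : V) :
  (\forall y \near x, phi y = chi y) -> differentiable phi x ->
  differentiable chi x.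
Proof.
move=> eqfg dphi; pose h : V -> W := chi - phi.
suff dh : differentiable h x.
  by rewrite (_ : chi = phi + h); [exact: differentiableD|rewrite /h addrC subrK].
(* The difference [h] vanishes near [x], so the zero map is its derivative. *)
pose l0 : {linear V -> W} := \0.
have l0c : continuous l0 by exact: cst_continuous.
have hE : h \o shift x = cst (h x) + l0 +o_ 0 id.
  apply/eqaddoP => _/posnumP[eps].
  have : \forall y \near (0 : V), phi (y + x) = chi (y + x).
    by rewrite (near_shift x) sub0r; near do rewrite /= subrK.
  apply: filterS => y E; rewrite [X in `|X|](_ : _ = 0); first by rewrite normr0 mulr_ge0.
  rewrite !fctE /h /= !fctE /= E subrr (nbhs_singleton eqfg) subrr.
  by rewrite addr0 oppr0 addr0.
have dE : 'd h x = l0 :> (V -> W) by exact: diff_unique.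
by apply/diff_locallyP; rewrite dE; split; [exact: l0c|exact: hE].
Unshelve. all: by end_near.
Qed.

(** * Calculus of iterated directional derivatives of C^k functions *)

Section IteratedDerivatives.
Variables (R : realType) (n : nat).
Implicit Types (U : set 'rV[R]_n) (phi chi : 'rV[R]_n -> R) (h e x : 'rV[R]_n).

Lemma near_eq_diff phi chi x h :
  (\forall y \near x, phi y = chi y) -> differentiable phi x ->
  'd phi x h = 'd chi x h.
Proof.
move=> E dphi; have dchi := near_eq_differentiable E dphi.
by rewrite -!deriveE//; exact: near_eq_derive.
Qed.

Lemma near_open_eq U phi chi x : open U -> (forall y, U y -> phi y = chi y) ->
  U x -> \forall y \near x, phi y = chi y.
Proof.
by move=> oU E Ux; apply: filterS (open_nbhs_nbhs (conj oU Ux)) => y /E.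
Qed.

Lemma Ck_eq U k phi chi : open U -> (forall y, U y -> phi y = chi y) ->
  Ck U k phi -> Ck U k chi.
Proof.
move=> oU; elim: k phi chi => [|k IH] phi chi E /=.
  move=> cphi x Ux; have cx : phi @ x --> phi x := cphi x Ux.
  change (chi @ x --> chi x); rewrite -(E _ Ux); move: cx.
  apply: cvg_trans; apply: (@near_eq_cvg _ _ (nbhs x)).
  exact: near_open_eq oU E Ux.
move=> [dphi Cphi]; split => [x Ux|h].
  by apply: near_eq_differentiable (dphi x Ux); exact: near_open_eq oU E Ux.
apply: IH (Cphi h) => y Uy.
by apply: near_eq_diff (dphi y Uy); exact: near_open_eq oU E Uy.
Qed.

(** The operator iterated in [Dpow]: [iter i (Dd h) phi x] unfolds to [Dpow i phi x h]. *)
Definition Dd h chi : 'rV[R]_n -> R := fun y => 'd chi y h.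

Lemma iter_Dd_eq U k phi chi h x : open U -> (forall y, U y -> phi y = chi y) ->
  Ck U k phi -> U x -> iter k (Dd h) phi x = iter k (Dd h) chi x.
Proof.
move=> oU; elim: k phi chi => [|k IH] phi chi E; first by move=> _ /E.
move=> [dphi Cphi] Ux; rewrite !iterSr; apply: IH (Cphi h) Ux => y Uy.
by apply: near_eq_diff (dphi y Uy); exact: near_open_eq oU E Uy.
Qed.

Lemma CkW U k phi : Ck U k.+1 phi -> Ck U k phi.
Proof.
elim: k phi => [|k IH] phi; last by move=> [d C]; split => // h; exact: IH.
by move=> [d _] x Ux; exact: differentiable_continuous (d x Ux).
Qed.

Lemma CkD U k phi chi : open U ->
  Ck U k phi -> Ck U k chi -> Ck U k (fun y => phi y + chi y).
Proof.
move=> oU; elim: k phi chi => [|k IH] phi chi /=.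
  by move=> c1 c2 x Ux; apply: continuousD; [exact: c1|exact: c2].
move=> [d1 C1] [d2 C2]; split => [x Ux|h].
  by apply: differentiableD; [exact: d1|exact: d2].
apply: Ck_eq (IH _ _ (C1 h) (C2 h)) => // y Uy.
by rewrite [RHS](_ : _ = ('d (phi + chi) y : _ -> _) h) // diffD//; [exact: d1|exact: d2].
Qed.

Lemma CkZ U k c phi : open U -> Ck U k phi -> Ck U k (fun y => c * phi y).
Proof.
move=> oU; elim: k phi => [|k IH] phi /=.
  by move=> c1 x Ux; apply: continuousM; [exact: cst_continuous|exact: c1].
move=> [d1 C1]; split => [x Ux|h].
  by apply: differentiableZ; exact: d1.
apply: Ck_eq (IH _ (C1 h)) => // y Uy.
by rewrite [RHS](_ : _ = ('d (c *: phi) y : _ -> _) h) // diffZ//; exact: d1.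
Qed.

Lemma Ck_cst U k (c : R) : open U -> Ck U k (fun=> c).
Proof.
move=> oU; elim: k c => [|k IH] c; first by move=> x _; exact: cst_continuous.
split => [x Ux|h]; first exact: differentiable_cst.
apply: Ck_eq (IH 0) => // y Uy.
by rewrite (_ : (fun=> c) = cst c)// diff_cst.
Qed.

Lemma Ck_sum U k (I : Type) (s : seq I) (c : I -> R) (phi : I -> 'rV[R]_n -> R) :
  open U -> (forall i, Ck U k (phi i)) ->
  Ck U k (fun y => \sum_(i <- s) c i * phi i y).
Proof.
move=> oU C; elim: s => [|i s IH].
  by under eq_fun do rewrite big_nil; exact: Ck_cst.
by under eq_fun do rewrite big_cons; apply: CkD => //; exact: CkZ.
Qed.

Lemma iter_DdD U k phi chi h x : open U -> Ck U k phi -> Ck U k chi -> U x ->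
  iter k (Dd h) (fun y => phi y + chi y) x =
  iter k (Dd h) phi x + iter k (Dd h) chi x.
Proof.
move=> oU; elim: k phi chi => [|k IH] phi chi // C1 C2 Ux; rewrite !iterSr.
rewrite -IH //; [|by case: C1 => _; exact|by case: C2 => _; exact].
apply: (@iter_Dd_eq U) => // [y Uy|]; last first.
  by have [_] := CkD oU C1 C2; exact.
case: C1 C2 => [d1 _] [d2 _].
by rewrite /Dd [LHS](_ : _ = ('d (phi + chi) y : _ -> _) h) // diffD//; [exact: d1|exact: d2].
Qed.

Lemma iter_DdZ U k c phi h x : open U -> Ck U k phi -> U x ->
  iter k (Dd h) (fun y => c * phi y) x = c * iter k (Dd h) phi x.
Proof.
move=> oU; elim: k phi => [|k IH] phi // C1 Ux; rewrite !iterSr.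
rewrite -IH //; last by case: C1 => _; exact.
apply: (@iter_Dd_eq U) => // [y Uy|]; last first.
  by have [_] := CkZ c oU C1; exact.
case: C1 => [d1 _].
by rewrite /Dd [LHS](_ : _ = ('d (c *: phi) y : _ -> _) h) // diffZ//; exact: d1.
Qed.

Lemma iter_Dd_cst k (c : R) h x :
  iter k.+1 (Dd h) (fun=> c) x = 0.
Proof.
have dc d y : Dd h (fun=> d) y = 0.
  by rewrite /Dd (_ : (fun=> d) = cst d)// diff_cst.
elim: k c => [|k IH] c; first exact: dc.
rewrite iterSr -[RHS](IH 0); congr (iter _ _ _ _); apply/funext => y; exact: dc.
Qed.

Lemma iter_Dd_sum U k (I : Type) (s : seq I) (c : I -> R)
    (phi : I -> 'rV[R]_n -> R) h x :
  open U -> (forall i, Ck U k (phi i)) -> U x ->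
  iter k (Dd h) (fun y => \sum_(i <- s) c i * phi i y) x =
  \sum_(i <- s) c i * iter k (Dd h) (phi i) x.
Proof.
move=> oU C Ux; elim: s => [|i s IH].
  rewrite big_nil; under eq_fun do rewrite big_nil.
  by case: k C => // k _; exact: iter_Dd_cst.
rewrite big_cons -IH; under eq_fun do rewrite big_cons.
rewrite (@iter_DdD U)//; [|exact: CkZ|exact: Ck_sum].
by rewrite (@iter_DdZ U).
Qed.

Lemma Dd_coord phi h x :
  Dd h phi x = \sum_(a < n) h ord0 a * Dd (delta_mx ord0 a) phi x.
Proof.
rewrite {1}(row_sum_delta h) /Dd linear_sum.
by apply: eq_bigr => a _; rewrite linearZ.
Qed.

(** Only the innermost direction is expanded. With [e := h] this is the recursion on the order: [h]
    survives as scalar coefficients and in derivatives of lower order of functions that do not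
    depend on [h]. *)
Lemma iter_Dd_coord U k phi h e x : open U -> Ck U k.+1 phi -> U x ->
  iter k (Dd h) (Dd e phi) x =
  \sum_(a < n) e ord0 a * iter k (Dd h) (Dd (delta_mx ord0 a) phi) x.
Proof.
move=> oU [dphi C] Ux.
rewrite -(@iter_Dd_sum U k _ _ (fun a => e ord0 a) (fun a => Dd (delta_mx ord0 a) phi))//; last by move=> a; exact: C.
by congr (iter _ _ _ _); apply/funext => y; exact: Dd_coord.
Qed.

End IteratedDerivatives.

(** * Restriction to lines and symmetry of second derivatives *)

Section DerivativesAlongLines.
Variables (R : realType) (n : nat).
Implicit Types (U : set 'rV[R]_n) (phi chi : 'rV[R]_n -> R) (h e u v x : 'rV[R]_n).

Lemma is_derive_line phi x h (t : R) : differentiable phi (x + t *: h) ->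
  is_derive t 1 (fun s => phi (x + s *: h)) (Dd h phi (x + t *: h)).
Proof.
move=> dphi; pose g : R -> 'rV[R]_n := cst x + ( *:%R ^~ h).
have dg : is_diff t g ( *:%R ^~ h : R -> 'rV[R]_n).
  by rewrite -[X in is_diff _ _ X]add0r; exact: is_diffD.
have dgt : differentiable g t by exact: ex_diff.
have dc : differentiable (phi \o g) t by exact: differentiable_comp.
apply: DeriveDef; first exact/derivable1_diffP.
by rewrite deriveE// diff_comp//= diff_val scale1r.
Qed.

(** The mean value theorem is used twice: in direction [u] for the difference of [phi] across
    [s *: v], then in direction [v]. The left-hand side is symmetric in [u] and [v], whence
    [Schwarz]. *)
Lemma second_difference U phi x u v (s : R) : Ck U 2 phi -> 0 < s ->
  (forall a b, a \in `[0, s] -> b \in `[0, s] -> U (x + a *: u + b *: v)) ->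
  exists a b, [/\ a \in `[0, s], b \in `[0, s] &
    phi (x + s *: u + s *: v) - phi (x + s *: u) - phi (x + s *: v) + phi x =
    s ^+ 2 * Dd v (Dd u phi) (x + a *: u + b *: v)].
Proof.
move=> [d1 C1] s0 Us; have [d2 _] := C1 u.
have s00 : 0 \in `[0, s] by rewrite in_itv /= lexx ltW.
have ss0 : s \in `[0, s] by rewrite in_itv /= lexx ltW.
pose F (a : R) := phi (x + s *: v + a *: u) - phi (x + a *: u).
have dF (a : R) : a \in `[0, s] -> is_derive a 1 F
    (Dd u phi (x + s *: v + a *: u) - Dd u phi (x + a *: u)).
  move=> ha; apply: is_deriveB; apply: is_derive_line; apply: d1.
    by rewrite addrAC; exact: Us.
  by have := Us a 0 ha s00; rewrite scale0r addr0.
have cont (F' dF' : R -> R) : (forall a, a \in `[0, s] -> is_derive a 1 F' (dF' a)) ->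
    {within `[0, s], continuous F'}.
  move=> H; apply: derivable_within_continuous => a ha.
  by have [] := H a ha.
have sub (a : R) : a \in `]0, s[ -> a \in `[0, s] by exact: subset_itv_oo_cc.
have [a a0s Ea] := MVT s0 (fun a ha => dF a (sub a ha)) (cont _ _ dF).
have dG (b : R) : b \in `[0, s] ->
    is_derive b 1 (fun b => Dd u phi (x + a *: u + b *: v))
      (Dd v (Dd u phi) (x + a *: u + b *: v)).
  by move=> hb; apply: is_derive_line; apply: d2; apply: Us => //; exact: sub.
have [b b0s Eb] := MVT s0 (fun a ha => dG a (sub a ha)) (cont _ _ dG).
exists a, b; split; [exact: sub|exact: sub|].
move: Ea Eb; rewrite /F !scale0r !addr0 subr0 => Ea Eb.
rewrite (addrAC x (s *: v)) (addrAC x (s *: v)) Eb in Ea.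
by rewrite mulrC expr2 mulrA -Ea; ring.
Qed.

Lemma Schwarz U phi x u v : open U -> Ck U 2 phi -> U x ->
  Dd u (Dd v phi) x = Dd v (Dd u phi) x.
Proof.
move=> oU C Ux; apply/eqP; rewrite -subr_eq0 -normr_le0; apply/ler_addgt0Pl => e e0.
rewrite addr0.
have cc w1 w2 : Dd w1 (Dd w2 phi) @ x --> Dd w1 (Dd w2 phi) x.
  by have [_ /(_ w2)[_ /(_ w1)]] := C; apply.
have e2 : 0 < e / 2 by rewrite divr_gt0.
have /cvgrPdist_lt/(_ _ e2) N1 := cc u v.
have /cvgrPdist_lt/(_ _ e2) N2 := cc v u.
have N3 := open_nbhs_nbhs (conj oU Ux).
have : nbhs x (U `&` ([set y | `|Dd u (Dd v phi) x - Dd u (Dd v phi) y| < e / 2] `&`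
    [set y | `|Dd v (Dd u phi) x - Dd v (Dd u phi) y| < e / 2])).
  by apply: filterI N3 (filterI N1 N2).
move=> /nbhs_ballP[d /= d0 Hd].
(* With this size the whole parallelogram stays in the ball of radius [d]; the [+ 1] covers
   [u = v = 0]. *)
pose s := d / (2 * (`|u| + `|v| + 1)).
have uv0 : 0 < `|u| + `|v| + 1 by rewrite ltr_wpDl// addr_ge0.
have s0 : 0 < s by rewrite divr_gt0 ?mulr_gt0.
have bxs (a b : R) : a \in `[0, s] -> b \in `[0, s] -> ball x d (x + a *: u + b *: v).
  rewrite !in_itv /= => /andP[a0 als] /andP[b0 bls].
  rewrite -ball_normE /= -addrA opprD addrA subrr add0r normrN.
  apply: (le_lt_trans (ler_normD _ _)); rewrite !normrZ !ger0_norm//.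
  apply: (@le_lt_trans _ _ (s * (`|u| + `|v| + 1))).
    by rewrite !mulrDr mulr1 -[leLHS]addr0 !lerD ?ler_wpM2r ?(ltW s0).
  have -> : s * (`|u| + `|v| + 1) = d / 2 by rewrite /s invfM mulrA divfK ?gt_eqF.
  by rewrite ltr_pdivrMr// mulr_natr mulr2n ltrDl.
have [a1 [b1 [ha1 hb1 E1]]] := second_difference C s0
  (fun a b ha hb => (Hd _ (bxs a b ha hb)).1).
have bxs' (a b : R) : a \in `[0, s] -> b \in `[0, s] -> ball x d (x + a *: v + b *: u).
  by move=> ha hb; rewrite addrAC; exact: bxs.
have [a2 [b2 [ha2 hb2 E2]]] := second_difference C s0
  (fun a b ha hb => (Hd _ (bxs' a b ha hb)).1).
have EE : Dd v (Dd u phi) (x + a1 *: u + b1 *: v) =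
          Dd u (Dd v phi) (x + a2 *: v + b2 *: u).
  apply: (mulfI (_ : s ^+ 2 != 0)); first by rewrite expf_neq0// gt_eqF.
  by rewrite -E1 -E2 (addrAC x (s *: v)); ring.
have [_ [_ H1]] := Hd _ (bxs a1 b1 ha1 hb1).
have [_ [H2 _]] := Hd _ (bxs' a2 b2 ha2 hb2).
move: H1 H2; rewrite /= -EE.
move: (Dd v (Dd u phi) (x + a1 *: u + b1 *: v)) => P.
move: (Dd u (Dd v phi) x) (Dd v (Dd u phi) x) => A B h1 h2.
have := ler_distD P A B; rewrite [`|P - B|]distrC; lra.
Qed.

End DerivativesAlongLines.

(** * The Euclidean norm and its comparison with the sup norm *)

Section EuclideanNorm.
Variables (R : realType) (n : nat).
Implicit Types (u v w : 'rV[R]_n) (c : R).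

Lemma dotpC u v : dotp u v = dotp v u.
Proof. by apply: eq_bigr => i _; rewrite mulrC. Qed.

Lemma dotpDl u v w : dotp (u + v) w = dotp u w + dotp v w.
Proof. by rewrite -big_split; apply: eq_bigr => i _; rewrite mxE mulrDl. Qed.

Lemma dotpZl c u w : dotp (c *: u) w = c * dotp u w.
Proof. by rewrite /dotp big_distrr; apply: eq_bigr => i _; rewrite /= mxE mulrA. Qed.

Lemma dotpDr u v w : dotp w (u + v) = dotp w u + dotp w v.
Proof. by rewrite dotpC dotpDl !(dotpC w). Qed.

Lemma dotpZr c u w : dotp w (c *: u) = c * dotp w u.
Proof. by rewrite dotpC dotpZl (dotpC w). Qed.

Lemma dotpBl u v w : dotp (u - v) w = dotp u w - dotp v w.
Proof. by rewrite dotpDl -scaleN1r dotpZl mulN1r. Qed.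

Lemma dotpNr u w : dotp w (- u) = - dotp w u.
Proof. by rewrite -scaleN1r dotpZr mulN1r. Qed.

Lemma dot0p u : dotp 0 u = 0.
Proof. by rewrite -(scale0r 0) dotpZl mul0r. Qed.

Lemma dotpp_ge0 u : 0 <= dotp u u.
Proof. by apply: sumr_ge0 => i _; rewrite -expr2 sqr_ge0. Qed.

Lemma enorm_ge0 u : 0 <= enorm u.
Proof. exact: sqrtr_ge0. Qed.

Lemma enorm_sqr u : enorm u ^+ 2 = dotp u u.
Proof. by rewrite sqr_sqrtr// dotpp_ge0. Qed.

Lemma enorm0 : enorm (0 : 'rV[R]_n) = 0.
Proof. by rewrite /enorm dot0p sqrtr0. Qed.

Lemma enormZ c u : enorm (c *: u) = `|c| * enorm u.
Proof.
by rewrite /enorm dotpZl dotpZr mulrA -expr2 sqrtrM ?sqr_ge0// sqrtr_sqr.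
Qed.

Lemma enormN u : enorm (- u) = enorm u.
Proof. by rewrite -scaleN1r enormZ normrN1 mul1r. Qed.

Lemma enormBC u v : enorm (u - v) = enorm (v - u).
Proof. by rewrite -enormN opprB. Qed.

Lemma dotpp_eq0 u : dotp u u = 0 -> u = 0.
Proof.
move=> /eqP; rewrite psumr_eq0; last by move=> i _; rewrite -expr2 sqr_ge0.
move=> /allP u0; apply/rowP => i; rewrite mxE; apply/eqP.
by have := u0 i (mem_index_enum i); rewrite /= -expr2 sqrf_eq0.
Qed.

Lemma enorm_eq0 u : enorm u = 0 -> u = 0.
Proof. by move=> u0; apply: dotpp_eq0; rewrite -enorm_sqr u0 expr0n. Qed.

Lemma enorm_gt0 u : u != 0 -> 0 < enorm u.
Proof.
by rewrite lt0r enorm_ge0 andbT; apply: contra_neq => /enorm_eq0.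
Qed.

(** Cauchy-Schwarz, from the nonnegativity of the squared norm of <v,v>u - <u,v>v. *)
Lemma dotp_le u v : `|dotp u v| <= enorm u * enorm v.
Proof.
rewrite -(ler_pXn2r (n := 2)) ?nnegrE ?mulr_ge0 ?enorm_ge0//.
rewrite exprMn !enorm_sqr -normrX ger0_norm ?sqr_ge0//.
have [v0|v0] := eqVneq (dotp v v) 0.
  by rewrite v0 (dotpp_eq0 v0) dotpC dot0p expr0n mulr0.
have vp : 0 < dotp v v by rewrite lt_neqAle eq_sym v0 dotpp_ge0.
have := dotpp_ge0 (dotp v v *: u - dotp u v *: v).
rewrite dotpBl !(dotpC _ (_ - _)) !dotpBl !dotpZl !dotpZr (dotpC v u).
rewrite (_ : _ - _ = dotp v v * (dotp u u * dotp v v - dotp u v ^+ 2)); last by ring.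
by rewrite pmulr_rge0// subr_ge0.
Qed.

Lemma enormD u v : enorm (u + v) <= enorm u + enorm v.
Proof.
rewrite -(ler_pXn2r (n := 2)) ?nnegrE ?addr_ge0 ?enorm_ge0//.
rewrite enorm_sqr dotpDl !dotpDr sqrrD !enorm_sqr (dotpC v u).
have := dotp_le u v; have := ler_norm (dotp u v); lra.
Qed.

Lemma enorm_dist w u v : enorm (u - v) <= enorm (u - w) + enorm (w - v).
Proof. by apply: le_trans (enormD _ _); rewrite addrA subrK. Qed.

Lemma norm_le_enorm u : `|u| <= enorm u.
Proof.
rewrite [`|u|]mx_normrE; apply/bigmax_leP; split => [|i _]; first exact: enorm_ge0.
rewrite -(ler_pXn2r (n := 2)) ?nnegrE ?enorm_ge0// enorm_sqr -normrX.
rewrite ger0_norm ?sqr_ge0// /dotp (bigD1 i.2)//= ord1 -expr2 lerDl.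
by apply: sumr_ge0 => j _; rewrite -expr2 sqr_ge0.
Qed.

Lemma enorm_le_norm u : enorm u <= n%:R * `|u|.
Proof.
rewrite -(ler_pXn2r (n := 2)) ?nnegrE ?enorm_ge0 ?mulr_ge0//.
rewrite enorm_sqr exprMn.
apply: (@le_trans _ _ (\sum_(i < n) `|u| ^+ 2)).
  apply: ler_sum => i _; rewrite -expr2 -[leLHS]ger0_norm ?sqr_ge0// normrX.
  rewrite ler_pXn2r ?nnegrE//.
  by rewrite [`|u|]mx_normrE; apply: (@le_bigmax_cond _ _ _ _ (ord0, i) _ (fun i => `|u i.1 i.2|)).
rewrite sumr_const card_ord -[X in X <= _]mulr_natl ler_wpM2r ?exprn_ge0//.
by rewrite -natrX ler_nat; case: (n) => // m; rewrite -[leqLHS]muln1 expnS expn1 leq_mul.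
Qed.

Lemma enorm_cvg (T : Type) (F : set_system T) (FF : Filter F)
    (g : T -> 'rV[R]_n) (a : 'rV[R]_n) :
  g @ F --> a -> (fun t => enorm (g t - a)) @ F --> (0 : R).
Proof.
move=> /cvgrPdist_lt ga; apply/cvgrPdist_lt => e e0.
(* [n.+1] rather than [n], so that the quotient is also meaningful in dimension 0. *)
have e1 : 0 < e / n.+1%:R by rewrite divr_gt0.
have := ga _ e1; apply: filterS => t.
rewrite distrC sub0r normrN ger0_norm ?enorm_ge0// ltr_pdivlMr// => H.
apply: le_lt_trans H; apply: le_trans (enorm_le_norm _) _.
by rewrite mulrC ler_wpM2l// ler_nat.
Qed.

Lemma near_enorm_lt (a : 'rV[R]_n) (e : R) : 0 < e -> \forall y \near a, enorm (y - a) < e.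
Proof.
move=> e0; have /cvgrPdist_lt/(_ _ e0) : (fun y => enorm (y - a)) @ a --> (0 : R).
  by apply: (@enorm_cvg _ (nbhs a) _ id a).
by apply: filterS => y; rewrite sub0r normrN ger0_norm ?enorm_ge0.
Qed.

Lemma enorm_cvgP (T : Type) (F : set_system T) (FF : Filter F)
    (g : T -> 'rV[R]_n) (a : 'rV[R]_n) :
  (forall e, 0 < e -> \forall t \near F, enorm (g t - a) < e) -> g @ F --> a.
Proof.
move=> H; apply/cvgrPdist_lt => e /H; apply: filterS => t.
by apply: le_lt_trans; rewrite distrC; exact: norm_le_enorm.
Qed.

Lemma enorm_continuous : continuous (@enorm R n).
Proof.
move=> a; apply/(@cvgrPdist_lt _ _ _ (nbhs a)) => e e0.
apply: (@filterS _ (nbhs a) _ _ _ _ (near_enorm_lt a e0)) => y.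
apply: le_lt_trans; rewrite ler_norml; apply/andP; split.
  by have := enormD (y - a) a; rewrite subrK; lra.
by have := enormD (a - y) y; rewrite subrK enormBC; lra.
Qed.

Lemma dotp_continuous v : continuous (fun u => dotp u v).
Proof.
move=> a; apply/(@cvgrPdist_lt _ _ _ (nbhs a)) => e e0.
have v1 : 0 < enorm v + 1 by rewrite ltr_wpDl ?enorm_ge0.
apply: (@filterS _ (nbhs a) _ _ _ _ (near_enorm_lt a (divr_gt0 e0 v1))) => y.
rewrite -dotpBl ltr_pdivlMr// enormBC; apply: le_lt_trans.
apply: le_trans (dotp_le _ _) _.
by rewrite ler_wpM2l ?enorm_ge0// lerDl.
Qed.

End EuclideanNorm.

(** * Derivative forms as polynomials along lines *)

(** Induction on the degree: Q(t) = P(t) - 2^D P(t/2) with D the top degree kills the leading term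
    and multiplies the linear coefficient by 1 - 2^(D-1), of modulus at least 1 when D >= 2. The
    constant depends on the degree alone; this is what makes polarization in [mixed_lipschitz]
    uniform. *)
Lemma poly_coef1_bound (R : realFieldType) (m : nat) : exists2 C : R, 0 <= C &
  forall (P : {poly R}) (K : R), (size P <= m.+1)%N ->
    (forall t, `|t| <= 1 -> `|P.[t]| <= K) -> `|P`_1| <= C * K.
Proof.
elim: m => [|[|m] [C C0 IH]].
- exists 0 => // P K sP _; rewrite mul0r nth_default ?normr0//.
- exists 2 => // P K sP PK.
  have P0 := PK 0; have P1 := PK 1; rewrite normr0 ler01 in P0.
  rewrite normr1 lexx in P1.
  have -> : P`_1 = P.[1] - P.[0].
    rewrite !(horner_coef_wide _ sP) !big_ord_recl !big_ord0 /=.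
    by rewrite !expr0 !expr1n !expr0n /= /bump /=; ring.
  have := ler_normB P.[1] P.[0]; have := P0 isT; have := P1 isT; lra.
- pose c : R := 2 ^+ m.+2.
  exists (C * (1 + c)); first by rewrite mulr_ge0// addr_ge0// exprn_ge0.
  move=> P K sP PK.
  pose Q := \poly_(i < m.+2) (P`_i * (1 - 2 ^+ (m.+2 - i))).
  have QE t : Q.[t] = P.[t] - c * P.[t / 2].
    rewrite horner_poly !(horner_coef_wide _ sP) mulr_sumr -sumrB [RHS]big_ord_recr /=.
    rewrite [X in _ + X](_ : _ = 0) ?addr0; last first.
      by rewrite exprMn exprVn /c; field; exact: expf_neq0.
    apply: eq_bigr => i _; rewrite exprMn exprVn /c.
    have -> : (2 : R) ^+ m.+2 = 2 ^+ (m.+2 - i) * 2 ^+ i.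
      by rewrite -exprD subnK// ltnW// ltn_ord.
    field; exact: expf_neq0.
  have := IH Q ((1 + c) * K) (size_poly _ _); rewrite coef_poly /= mulrA.
  have c1 : 1 <= (2 : R) ^+ m by apply: exprn_ege1; rewrite ler1n.
  move=> H; apply: le_trans (H _); last first.
    move=> t t1; rewrite QE mulrDl mul1r; apply: le_trans (ler_normB _ _) _.
    rewrite lerD ?PK// normrM [`|c|]ger0_norm ?exprn_ge0// ler_wpM2l ?exprn_ge0//.
    by apply: PK; rewrite normrM [`|2^-1|]ger0_norm//; lra.
  rewrite normrM -[leLHS]mulr1 ler_wpM2l// subSS subn0 exprS distrC ger0_norm; lra.
Qed.

Lemma continuous_sumr (R : realType) (T : topologicalType) (I : Type)
    (s : seq I) (F : I -> T -> R) :
  (forall i, continuous (F i)) -> continuous (fun x => \sum_(i <- s) F i x).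
Proof.
move=> cF x; elim: s => [|i s IH].
  by under eq_fun do rewrite big_nil; exact: cst_continuous.
under eq_fun do rewrite big_cons; apply: continuousD; [exact: cF|exact: IH].
Qed.

Section Polynomials.
Variables (R : realType) (n : nat).
Implicit Types (U : set 'rV[R]_n) (phi chi : 'rV[R]_n -> R) (h e u v x : 'rV[R]_n).

Lemma Ck_le U j k phi : (j <= k)%N -> Ck U k phi -> Ck U j phi.
Proof.
move=> /subnK <-; elim: (k - j)%N => // i IH C.
by apply: IH; apply: CkW.
Qed.

Lemma iter_Dd_continuous U i phi x : open U -> Ck U i phi -> U x ->
  continuous (fun h => iter i (Dd h) phi x).
Proof.
move=> oU; elim: i phi => [|i IH] phi C Ux; first exact: cst_continuous.
have -> : (fun h => iter i.+1 (Dd h) phi x) = (fun h =>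
    \sum_(a < n) h ord0 a * iter i (Dd h) (Dd (delta_mx ord0 a) phi) x).
  by apply/funext => h; rewrite iterSr (iter_Dd_coord _ _ oU C Ux).
apply: continuous_sumr => a h.
have ca : continuous (fun k : 'rV[R]_n => k ord0 a) by exact: coord_continuous.
have ci : continuous (fun k => iter i (Dd k) (Dd (delta_mx ord0 a) phi) x).
  by apply: IH => //; case: C => _; exact.
exact: (continuousM (ca h) (ci h)).
Qed.

Lemma iter_DdS_sum U i phi h x : open U -> Ck U i.+1 phi -> U x ->
  iter i.+1 (Dd h) phi x =
  \sum_(a < n) h ord0 a * iter i (Dd h) (Dd (delta_mx ord0 a) phi) x.
Proof. by move=> oU C Ux; rewrite iterSr (iter_Dd_coord _ _ oU C Ux). Qed.

(** The multilinear expansion of D^i phi(x)[h + t e]^i, with linear coefficient i D^i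
    phi(x)[e, h, ..., h]. Peeling off one coordinate direction yields a new term plus i terms by
    induction, and [Schwarz] moves [e] innermost so that they all coincide. *)
Lemma iter_Dd_poly U i phi x h e : open U -> Ck U i phi -> U x ->
  exists P : {poly R}, [/\ (size P <= i.+1)%N,
    forall t, iter i (Dd (h + t *: e)) phi x = P.[t] &
    P`_1 = i%:R * iter i.-1 (Dd h) (Dd e phi) x].
Proof.
move=> oU; elim: i phi => [|i IH] phi C Ux.
  exists (phi x)%:P; split => [|t|]; first exact: size_polyC_leq1.
    by rewrite hornerC.
  by rewrite coefC mul0r.
have [_ C'] := C.
have /choice[P HP] := fun a => IH _ (C' (delta_mx ord0 a)) Ux.
exists (\sum_(a < n) ((h ord0 a)%:P + e ord0 a *: 'X) * P a); split.
- apply: (leq_trans (size_sum _ _ _)); apply/bigmax_leqP => a _.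
  have [sP _ _] := HP a.
  apply: (leq_trans (size_polyMleq _ _)).
  have : (size ((h ord0 a)%:P + e ord0 a *: 'X)%R <= 2)%N.
    apply: (leq_trans (size_polyD _ _)); rewrite geq_max.
    rewrite (leq_trans (size_polyC_leq1 _))//.
    by rewrite (leq_trans (size_scale_leq _ _))// size_polyX.
  by move=> /leq_add/(_ sP); case: (_ + _)%N.
- move=> t; rewrite (iter_DdS_sum _ oU C Ux) horner_sum; apply: eq_bigr => a _.
  have [_ -> _] := HP a.
  by rewrite hornerM hornerD hornerC hornerZ hornerX !mxE [t * _]mulrC.
rewrite coef_sum.
transitivity (\sum_(a < n) (e ord0 a * iter i (Dd h) (Dd (delta_mx ord0 a) phi) x +
    i%:R * (h ord0 a * iter i.-1 (Dd h) (Dd e (Dd (delta_mx ord0 a) phi)) x))).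
  apply: eq_bigr => a _; have [_ PE P1] := HP a.
  rewrite mulrDl coefD coefCM P1 -scalerAl coefZ coefXM /= -horner_coef0 -PE.
  by rewrite scale0r addr0; ring.
rewrite big_split/= -(iter_Dd_coord _ _ oU C Ux) -mulr_sumr.
rewrite mulrSr mulrDl mul1r addrC; congr (_ + _).
case: i {IH P HP} C C' => [|i] C C'; first by rewrite !mul0r.
congr (_ * _); rewrite [RHS]/= -[RHS]/(iter i.+1 (Dd h) (Dd e phi) x).
have Ce : Ck U i.+1 (Dd e phi) by exact: C'.
rewrite (iter_DdS_sum _ oU Ce Ux); apply: eq_bigr => a _; congr (_ * _).
have [_ Ca] := C' (delta_mx ord0 a).
apply: (@iter_Dd_eq _ _ U) => //; last exact: Ca.
by move=> y Uy; apply: (@Schwarz _ _ U) => //; exact: Ck_le C.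
Qed.

Lemma iter_Dd_scale U i phi x (c : R) h : open U -> Ck U i phi -> U x ->
  iter i (Dd (c *: h)) phi x = c ^+ i * iter i (Dd h) phi x.
Proof.
move=> oU; elim: i phi => [|i IH] phi C Ux; first by rewrite mul1r.
have [_ C'] := C.
rewrite !(iter_DdS_sum _ oU C Ux) mulr_sumr; apply: eq_bigr => a _.
by rewrite (IH _ (C' _) Ux) mxE exprS; ring.
Qed.

End Polynomials.

(** * Taylor's formula with a Lipschitz top derivative *)

Lemma derive_ge0_le (R : realType) (H dH : R -> R) :
  (forall t : R, 0 <= t <= 1 -> is_derive t 1 H (dH t)) ->
  (forall t : R, 0 <= t <= 1 -> 0 <= dH t) ->
  forall t : R, 0 <= t <= 1 -> H 0 <= H t.
Proof.
move=> HdH dH0 t /andP[t0 t1].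
have sub (s : R) : s \in `[0, t] -> 0 <= s <= 1.
  by rewrite in_itv/= => /andP[-> /le_trans->].
have dH1 (s : R) : s \in `]0, t[ -> is_derive s 1 H (dH s).
  by move=> hs; apply: HdH; apply: sub; exact: subset_itv_oo_cc.
have cH : {within `[0, t], continuous H}.
  by apply: derivable_within_continuous => s /sub/HdH[].
have [c hc E] := MVT_segment t0 dH1 cH.
by rewrite -subr_ge0 E subr0 mulr_ge0// dH0// sub.
Qed.

(** [phi i] stands for the i-th derivative of [phi 0]. Taking the family as data makes the
    derivative of this polynomial the Taylor polynomial of the shifted family. *)
Definition taylor_poly (R : realType) (m : nat) (phi : nat -> R -> R) : {poly R} :=
  \poly_(i < m.+1) (phi i 0 / i`!%:R).

(** Induction on the shifted family bounds the derivative of the remainder by B', where B(t) = K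
    t^(m+2)/(m+2)!. So B minus and plus the remainder are both nondecreasing from 0. *)
Lemma taylor_poly_bound (R : realType) (m : nat) (phi : nat -> R -> R) (K : R) :
  (forall i (t : R), (i < m)%N -> 0 <= t <= 1 -> is_derive t 1 (phi i) (phi i.+1 t)) ->
  (forall t : R, 0 <= t <= 1 -> `|phi m t - phi m 0| <= K * t) ->
  forall t : R, 0 <= t <= 1 ->
  `|phi 0%N t - (taylor_poly m phi).[t]| <= K / m.+1`!%:R * t ^+ m.+1.
Proof.
elim: m phi => [|m IH] phi dphi Kphi t t01.
  rewrite /taylor_poly horner_poly big_ord1 expr0 mulr1 divr1 expr1 divr1.
  exact: Kphi.
have IHS := IH (fun i => phi i.+1) (fun i => dphi i.+1) Kphi.
pose T := taylor_poly m.+1 phi.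
have fz k : k`!%:R != 0 :> R by rewrite pnatr_eq0 -lt0n fact_gt0.
have dT : T^`() = taylor_poly m (fun i => phi i.+1).
  apply/polyP => i; rewrite coef_deriv !coef_poly ltnS.
  case: ifP => _; last by rewrite mul0rn.
  rewrite factS natrM -mulr_natr.
  by field; rewrite fz addrC natr1 pnatr_eq0.
pose B : {poly R} := (K / m.+2`!%:R) *: 'X^(m.+2).
have dB s : (B^`()).[s] = K / m.+1`!%:R * s ^+ m.+1.
  rewrite derivZ derivXn hornerZ hornerMn hornerXn (factS m.+1) natrM -mulr_natr.
  by field; rewrite fz -natrD pnatr_eq0.
have T0 : T.[0] = phi 0%N 0.
  by rewrite horner_coef0 coef_poly divr1.
have B0 : B.[0] = 0 by rewrite hornerZ hornerXn expr0n mulr0.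
have BE s : B.[s] = K / m.+2`!%:R * s ^+ m.+2 by rewrite hornerZ hornerXn.
have d0 (s : R) : 0 <= s <= 1 -> is_derive s 1 (phi 0%N) (phi 1%N s) by exact: dphi.
have bnd (s : R) : 0 <= s <= 1 -> `|phi 1%N s - T^`().[s]| <= B^`().[s].
  by move=> s01; rewrite dT dB; exact: IHS.
have dH (s : R) : 0 <= s <= 1 ->
    is_derive s 1 (phi 0%N - horner T) (phi 1%N s - T^`().[s]).
  by move=> s01; have d0s := d0 s s01; exact: is_deriveB.
have d1 (s : R) : 0 <= s <= 1 -> is_derive s 1 (horner B - (phi 0%N - horner T))
    (B^`().[s] - (phi 1%N s - T^`().[s])).
  by move=> s01; have dHs := dH s s01; exact: is_deriveB.
have d2 (s : R) : 0 <= s <= 1 -> is_derive s 1 (horner B + (phi 0%N - horner T))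
    (B^`().[s] + (phi 1%N s - T^`().[s])).
  by move=> s01; have dHs := dH s s01; exact: is_deriveD.
have p1 (s : R) : 0 <= s <= 1 -> 0 <= B^`().[s] - (phi 1%N s - T^`().[s]).
  by move=> /bnd; rewrite ler_norml subr_ge0 => /andP[].
have p2 (s : R) : 0 <= s <= 1 -> 0 <= B^`().[s] + (phi 1%N s - T^`().[s]).
  by move=> /bnd; rewrite ler_norml -subr_ge0 opprK addrC => /andP[].
have H1 := derive_ge0_le d1 p1 t01; have H2 := derive_ge0_le d2 p2 t01.
rewrite !fctE T0 B0 subrr BE oppr0 addr0 subr_ge0 in H1.
rewrite !fctE T0 B0 subrr BE addr0 addrC -lerBlDr sub0r in H2.
by rewrite ler_norml H1 H2.
Qed.

Section Taylor.
Variables (R : realType) (n : nat).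
Implicit Types (U D : set 'rV[R]_n) (phi : 'rV[R]_n -> R) (h e u v x y : 'rV[R]_n).

Definition segment_closed D := forall x y (t : R),
  D x -> D y -> 0 <= t <= 1 -> D (x + t *: (y - x)).

(** [symnorm] tests directions of the unit ball; homogeneity of degree [p] extends the bound to
    every [h]. *)
Lemma lipschitz_D_homog U D p phi (L : R) x y h : open U -> D `<=` U ->
  (0 < p)%N -> Ck U p phi -> lipschitz_D D p phi L -> D x -> D y ->
  `|iter p (Dd h) phi x - iter p (Dd h) phi y| <= L * enorm (x - y) * enorm h ^+ p.
Proof.
move=> oU DU p0 C lip Dx Dy; have Ux := DU _ Dx; have Uy := DU _ Dy.
have [->|h0] := eqVneq h 0.
  rewrite -[in leLHS](scale0r 0) !(iter_Dd_scale _ _ oU C)//.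
  by rewrite enorm0 !expr0n (gtn_eqF p0) !mul0r subrr normr0 mulr0.
have hh := enorm_gt0 h0.
have [g [E g1]] : exists g, h = enorm h *: g /\ enorm g <= 1.
  exists ((enorm h)^-1 *: h); rewrite scalerA divff ?gt_eqF// scale1r; split => //.
  by rewrite enormZ ger0_norm ?invr_ge0 ?enorm_ge0// mulVf// gt_eqF.
rewrite [in leLHS]E !(iter_Dd_scale _ _ oU C)// -mulrBr normrM ger0_norm ?exprn_ge0 ?enorm_ge0//.
rewrite mulrC ler_wpM2r ?exprn_ge0 ?enorm_ge0// -lee_fin.
apply: le_trans (lip x y Dx Dy); apply: ereal_sup_ubound.
by exists g.
Qed.

Lemma taylorE p phi y x :
  taylor p phi y x = \sum_(i < p.+1) iter i (Dd (y - x)) phi x / i`!%:R.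
Proof.
rewrite big_ord_recl /= divr1 /taylor; congr (_ + _).
by rewrite big_add1 big_mkord; apply: eq_bigr => i _; rewrite mulrC.
Qed.

Lemma iter_Dd_differentiable U k i phi h x : (i < k)%N -> Ck U k phi -> U x ->
  differentiable (iter i (Dd h) phi) x.
Proof.
move=> /subnK <-; rewrite addnS; move: (k - i.+1)%N => j.
elim: i phi => [|i IH] phi; first by case=> d _; exact: d.
by rewrite addnS iterSr => -[_ /(_ h) C']; exact: IH.
Qed.

(** Apply [taylor_poly_bound] to t -> phi(x + t(y - x)), whose p-th derivative varies by at most L
    |y - x|^(p+1) t from its value at 0. *)
Lemma taylor_remainder U D p phi (L : R) x y : open U -> D `<=` U ->
  segment_closed D -> (0 < p)%N -> Ck U p phi -> lipschitz_D D p phi L ->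
  D x -> D y ->
  `|phi y - taylor p phi y x| <= L / p.+1`!%:R * enorm (y - x) ^+ p.+1.
Proof.
move=> oU DU sD p0 C lip Dx Dy; pose h := y - x.
have xh : x + h = y by rewrite addrC subrK.
pose F i (t : R) := iter i (Dd h) phi (x + t *: h).
have := @taylor_poly_bound R p F (L * enorm h ^+ p.+1) _ _ 1.
rewrite ler01 lexx expr1n mulr1 => H.
rewrite mulrAC; apply: le_trans (H _ _ _) => //.
- rewrite /taylor_poly horner_poly /F /= scale1r xh taylorE.
  by under [in leRHS]eq_bigr do rewrite expr1n mulr1 scale0r addr0.
- move=> i t ip t01; rewrite /F iterS; apply: is_derive_line.
  have Ut : U (x + t *: h) by apply: DU; exact: sD.
  exact: iter_Dd_differentiable ip C Ut.
- move=> t t01; rewrite /F scale0r addr0.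
  have := lipschitz_D_homog h oU DU p0 C lip (sD _ _ _ Dx Dy t01) Dx.
  have [t0 _] := andP t01.
  rewrite (addrC x) addrK enormZ (ger0_norm t0) => /le_trans; apply.
  by rewrite exprS le_eqVlt; apply/orP; left; apply/eqP; ring.
Qed.

(** Polarization: the hypothesis controls D^p phi(x)[h]^p - D^p phi(y)[h]^p, while gradients involve
    D^p phi[e, h, ..., h]. The latter is, up to a factor, the linear coefficient of t -> D^p
    phi[h + t c e]^p, to which [poly_coef1_bound] applies. The factor |h| kept on both sides avoids
    the power p - 1. *)
Lemma mixed_lipschitz p : exists2 C : R, 0 <= C &
  forall U D phi (L : R) x y h e, open U -> D `<=` U -> (0 < p)%N -> 0 <= L ->
  Ck U p phi -> lipschitz_D D p phi L -> D x -> D y ->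
  `|iter p.-1 (Dd h) (Dd e phi) x - iter p.-1 (Dd h) (Dd e phi) y| * enorm h <=
  C * L * enorm (x - y) * enorm h ^+ p * enorm e.
Proof.
have [C C0 HC] := poly_coef1_bound R p.
exists (C * 2 ^+ p); first by rewrite mulr_ge0 ?exprn_ge0.
move=> U D phi L x y h e oU DU p0 L0 Ck lip Dx Dy.
have Ux := DU _ Dx; have Uy := DU _ Dy.
have [e0|e0] := eqVneq e 0.
  rewrite e0 enorm0 mulr0.
  have E z : U z -> iter p.-1 (Dd h) (Dd 0 phi) z = 0.
    move=> Uz; rewrite (@iter_Dd_coord _ _ U)//; last by rewrite prednK.
    by rewrite big1// => a _; rewrite mxE mul0r.
  by rewrite !E// subrr normr0 mul0r.
have [h0|h0] := eqVneq (enorm h) 0.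
  by rewrite h0 mulr0 expr0n (gtn_eqF p0) mulr0 mul0r.
have ee := enorm_gt0 e0; have hp : 0 < enorm h by rewrite lt_neqAle eq_sym h0 enorm_ge0.
(* Balancing the two directions gives |h + t c e| <= 2|h| for |t| <= 1. *)
pose c := enorm h / enorm e.
have [P [sP PE P1]] := iter_Dd_poly h (c *: e) oU Ck Ux.
have [Q [sQ QE Q1]] := iter_Dd_poly h (c *: e) oU Ck Uy.
have sPQ : (size (P - Q)%R <= p.+1)%N.
  by rewrite (leq_trans (size_polyD _ _))// geq_max sP size_polyN.
have := HC (P - Q) (L * enorm (x - y) * (2 * enorm h) ^+ p) sPQ.
have Dc : Dd (c *: e) phi = fun z => c * Dd e phi z.
  by apply/funext => z; rewrite /Dd linearZ.
have C' : Defs.Ck U p.-1 (Dd e phi).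
  by move: Ck; rewrite -(prednK p0) => -[_]; exact.
have mixE : (P - Q)`_1 = p%:R * c *
    (iter p.-1 (Dd h) (Dd e phi) x - iter p.-1 (Dd h) (Dd e phi) y).
  by rewrite coefB P1 Q1 Dc !(@iter_DdZ _ _ U)//; ring.
move=> key; have {key} : `|(P - Q)`_1| <= C * (L * enorm (x - y) * (2 * enorm h) ^+ p).
  apply: key => t t1; rewrite hornerD hornerN -PE -QE.
  apply: le_trans (lipschitz_D_homog _ oU DU p0 Ck lip Dx Dy) _.
  rewrite ler_wpM2l ?mulr_ge0 ?enorm_ge0//.
  rewrite lerXn2r ?nnegrE ?enorm_ge0 ?mulr_ge0 ?enorm_ge0//.
    apply: le_trans (enormD _ _) _; rewrite scalerA enormZ normrM.
  have -> : `|c| = c by rewrite ger0_norm// divr_ge0 ?enorm_ge0.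
  by rewrite -mulrA divfK ?gt_eqF// mulr_natl mulr2n lerD2l ler_piMl ?enorm_ge0.
rewrite mixE normrM ger0_norm; last by rewrite mulr_ge0// divr_ge0 ?enorm_ge0.
set mix := `|_ - _|; have mix0 : 0 <= mix by exact: normr_ge0.
have p1 : 1 <= p%:R :> R by rewrite ler1n.
rewrite /c mulrA mulrAC ler_pdivrMr// => key.
rewrite exprMn in key.
apply: le_trans (_ : p%:R * (mix * enorm h) <= _).
  by rewrite ler_peMl// mulr_ge0// ltW.
apply: le_trans (_ : p%:R * enorm h * mix <= _); first by rewrite mulrAC mulrA.
apply: le_trans key _; rewrite le_eqVlt; apply/orP; left; apply/eqP; ring.
Qed.

End Taylor.

(** * Gradients of the Taylor polynomial and of powers of the norm *)

Section TaylorGradient.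
Variables (R : realType) (n : nat).
Implicit Types (U D : set 'rV[R]_n) (phi : 'rV[R]_n -> R) (h e u v x y : 'rV[R]_n).

(* The derivative of [y |-> taylor p phi y x] in the direction [e]. *)
Definition dtaylor p phi y x e : R :=
  \sum_(j < p) iter j (Dd (y - x)) (Dd e phi) x / j`!%:R.

(** By [iter_Dd_poly] the function of [t] is a polynomial. The factor i of its i-th linear
    coefficient turns 1/i! into 1/(i-1)!, whence the index shift in [dtaylor]. *)
Lemma is_derive_taylor U p phi x y e : open U -> Ck U p phi -> U x ->
  is_derive (0 : R) 1 (fun t => taylor p phi (y + t *: e) x) (dtaylor p phi y x e).
Proof.
move=> oU C Ux.
have C' (i : 'I_p.+1) : Ck U i phi by apply: Ck_le C; rewrite -ltnS.
have /choice[P HP] := fun i : 'I_p.+1 => iter_Dd_poly (y - x) e oU (C' i) Ux.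
pose T := \sum_(i < p.+1) (i`!%:R)^-1 *: P i.
have -> : (fun t => taylor p phi (y + t *: e) x) = horner T.
  apply/funext => t; rewrite taylorE horner_sum; apply: eq_bigr => i _.
  by have [_ PE _] := HP i; rewrite hornerZ -PE addrAC mulrC.
have -> : dtaylor p phi y x e = (T^`()).[0].
  rewrite horner_coef0 coef_deriv coef_sum mulr1n big_ord_recl coefZ.
  have [_ _ ->] := HP ord0; rewrite mul0r mulr0 add0r.
  apply: eq_bigr => j _; rewrite coefZ; have [_ _ ->] := HP (lift ord0 j).
  rewrite lift0 /= factS natrM; field.
  by rewrite [1 + _]addrC natr1 !pnatr_eq0 -!lt0n fact_gt0.
exact: is_derive_poly.
Qed.

Lemma dtaylor_coord U p phi x y e : open U -> Ck U p phi -> U x ->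
  dtaylor p phi y x e = \sum_(a < n) e ord0 a * dtaylor p phi y x (delta_mx ord0 a).
Proof.
move=> oU C Ux; rewrite /dtaylor; under [RHS]eq_bigr do rewrite mulr_sumr.
rewrite exchange_big; apply: eq_bigr => j _ /=.
rewrite (@iter_Dd_coord _ _ U)//; last exact: Ck_le C.
by rewrite mulr_suml; apply: eq_bigr => a _; rewrite mulrA.
Qed.

Lemma dtaylor_continuous U p phi x e : open U -> Ck U p phi -> U x ->
  continuous (fun y => dtaylor p phi y x e).
Proof.
move=> oU C Ux; apply: continuous_sumr => j y.
have C' : Ck U j (Dd e phi).
  by have /= [_] := Ck_le (ltn_ord j) C; exact.
have c1 := iter_Dd_continuous oU C' Ux.
have c2 : {for y, continuous (fun z : 'rV[R]_n => iter j (Dd (z - x)) (Dd e phi) x)}.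
  apply: (@continuous_comp _ _ _ (fun z : 'rV[R]_n => z - x) (fun h => iter j (Dd h) (Dd e phi) x)).
    by apply: continuousB; [exact: id|exact: cst_continuous].
  exact: c1.
exact: (continuousM c2 (@cst_continuous _ _ (j`!%:R^-1 : R) y)).
Qed.

(** [dtaylor] is the Taylor polynomial of order p - 1 of [Dd e phi], and [mixed_lipschitz] supplies
    the Lipschitz bound on its top derivative along the segment. *)
Lemma taylor_grad p : exists2 C : R, 0 <= C &
  forall U D phi (L : R) x y e, open U -> D `<=` U -> segment_closed D ->
  (0 < p)%N -> 0 <= L -> Ck U p phi -> lipschitz_D D p phi L -> D x -> D y ->
  `|Dd e phi y - dtaylor p phi y x e| <= C * L * enorm (y - x) ^+ p * enorm e.
Proof.
have [C C0 HC] := mixed_lipschitz R n p; exists C => //.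
move=> U D phi L x y e oU DU sD p0 L0 Ck lip Dx Dy.
pose h := y - x; have xh : x + h = y by rewrite addrC subrK.
pose K := C * L * enorm h ^+ p * enorm e.
have K0 : 0 <= K by rewrite !mulr_ge0 ?exprn_ge0 ?enorm_ge0.
pose F i (t : R) := iter i (Dd h) (Dd e phi) (x + t *: h).
have Ce : Defs.Ck U p.-1 (Dd e phi).
  by move: Ck; rewrite -(prednK p0) => -[_]; exact.
have := @taylor_poly_bound R p.-1 F K _ _ 1.
rewrite ler01 lexx expr1n mulr1 => H.
apply: le_trans (_ : K / p.-1.+1`!%:R <= K); last first.
  by rewrite ler_pdivrMr ?ltr0n ?fact_gt0// ler_peMr// ler1n fact_gt0.
apply: le_trans (H _ _ _) => //.
- rewrite /taylor_poly horner_poly /F /= scale1r xh /dtaylor prednK//.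
  by under [in leRHS]eq_bigr do rewrite expr1n mulr1 scale0r addr0.
- move=> i t ip t01; rewrite /F iterS; apply: is_derive_line.
  by apply: (iter_Dd_differentiable _ ip Ce); apply: DU; exact: sD.
move=> t t01; rewrite /F scale0r addr0.
have [h0|h0] := eqVneq h 0.
  by rewrite h0 scaler0 addr0 subrr normr0 mulr_ge0//; case/andP: t01.
have hp := enorm_gt0 h0.
rewrite -(ler_pM2r hp).
have := HC U D phi L (x + t *: h) x h e oU DU p0 L0 Ck lip (sD _ _ _ Dx Dy t01) Dx.
have [t0 _] := andP t01.
rewrite (addrC x) addrK enormZ (ger0_norm t0) => /le_trans; apply.
by rewrite le_eqVlt; apply/orP; left; apply/eqP; rewrite /K; ring.
Qed.

Lemma is_derive_quad (F : R -> R) (C : R) : F 0 = 0 ->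
  (forall t, `|t| <= 1 -> `|F t| <= C * t ^+ 2) -> is_derive (0 : R) 1 F 0.
Proof.
move=> F0 FC.
have C0 : 0 <= C.
  by have := FC 1; rewrite normr1 lexx expr1n mulr1 => /(_ isT)/(le_trans _); apply.
have cF : (fun s : R => s^-1 *: (F (s *: 1 + 0) - F 0)) @ 0^' --> (0 : R).
  apply/cvgrPdist_lt => e e0; near=> s.
  have s0 : s != 0 by near: s; exact: nbhs_dnbhs_neq.
  have s1 : `|s| < Num.min 1 (e / (C + 1)).
    near: s; apply: dnbhs0_lt; rewrite lt_min ltr01 divr_gt0//; lra.
  move: s1; rewrite lt_min => /andP[s1 s2].
  rewrite F0 subr0 addr0 sub0r normrN normrZ normfV [_ *: 1]mulr1.
  rewrite ltr_pdivrMl ?normr_gt0//.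
  apply: le_lt_trans (FC _ (ltW s1)) _.
  have -> : s ^+ 2 = `|s| * `|s| by rewrite -normrM -expr2 ger0_norm ?sqr_ge0.
  rewrite mulrCA ltr_pM2l ?normr_gt0//.
  move: s2; rewrite ltr_pdivlMr; last lra.
  have := normr_ge0 s; lra.
by apply: DeriveDef; [apply/cvg_ex; exists 0|exact: cvg_lim].
Unshelve. all: by end_near. Qed.

(** Away from [h = 0] this is the chain rule through the square root of a positive quadratic. At
    [h = 0] the square root is not differentiable, but the power p + 1 >= 2 makes the function
    O(t^2). *)
Lemma is_derive_enormX p h e : (0 < p)%N ->
  is_derive (0 : R) 1 (fun t => enorm (h + t *: e) ^+ p.+1)
    (p.+1%:R * enorm h ^+ p.-1 * dotp h e).
Proof.
move=> p0; have [->|h0] := eqVneq h 0.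
  rewrite dot0p mulr0; apply: (@is_derive_quad _ (enorm e ^+ p.+1)).
    by rewrite scale0r addr0 enorm0 expr0n.
  move=> t t1; rewrite add0r enormZ exprMn normrM normrX normr_id.
  rewrite [X in _ * X]ger0_norm ?exprn_ge0 ?enorm_ge0//.
  rewrite mulrC ler_wpM2l ?exprn_ge0 ?enorm_ge0//.
  by rewrite -[leRHS]ger0_norm ?sqr_ge0// normrX; apply: ler_wiXn2l.
pose q : {poly R} := (dotp h h)%:P + (2 * dotp h e) *: 'X + dotp e e *: 'X^2.
have qE t : dotp (h + t *: e) (h + t *: e) = q.[t].
  rewrite /q !hornerD hornerC !hornerZ hornerX hornerXn.
  by rewrite !(dotpDl, dotpDr, dotpZl, dotpZr) (dotpC e h); ring.
have dq : is_derive (0 : R) 1 (horner q) (2 * dotp h e).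
  have -> : 2 * dotp h e = (q^`()).[0]; last exact: is_derive_poly.
  by rewrite horner_coef0 coef_deriv !coefE /= mulr1n; ring.
have hh := enorm_gt0 h0.
have q0 : 0 < q.[0] by rewrite -qE scale0r addr0 -enorm_sqr exprn_gt0.
have ds : is_derive q.[0] 1 (@Num.sqrt R) (2 * Num.sqrt q.[0])^-1.
  exact: is_derive1_sqrt.
have -> : (fun t => enorm (h + t *: e) ^+ p.+1) = (Num.sqrt \o horner q) ^+ p.+1.
  by apply/funext => t; rewrite fctE /= /enorm qE.
have dc := is_derive1_comp ds dq.
apply: is_derive_eq.
have -> : (Num.sqrt \o horner q) 0 = enorm h by rewrite /= -qE scale0r addr0.
have -> : Num.sqrt q.[0] = enorm h by rewrite -qE scale0r addr0.
rewrite /= -[_ *: _]/(_ * _).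
have -> : enorm h ^+ p = enorm h * enorm h ^+ p.-1 by rewrite -exprS prednK.
by field; rewrite gt_eqF.
Qed.

End TaylorGradient.

(** * Subdifferentials of smooth plus convex functions *)

Lemma cvg_sumr (R : realType) (T I : Type) (F : set_system T) (FF : Filter F)
    (s : seq I) (f : I -> T -> R) (l : I -> R) :
  (forall i, f i @ F --> l i) ->
  (fun t => \sum_(i <- s) f i t) @ F --> \sum_(i <- s) l i.
Proof.
move=> fl; elim: s => [|i s IH].
  rewrite big_nil; under eq_fun do rewrite big_nil; exact: cvg_cst.
by rewrite big_cons; under eq_fun do rewrite big_cons; exact: cvgD.
Qed.

Lemma is_derive_approx (R : realType) (k : R -> R) (D : R) :
  is_derive (0 : R) 1 k D -> forall e, 0 < e ->
  \forall t \near (0 : R), `|k t - k 0 - t * D| <= e * `|t|.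
Proof.
move=> [dk kD] e e0.
have : (fun s : R => s^-1 *: (k (s *: 1 + 0) - k 0)) @ 0^' --> D.
  by rewrite -kD; exact: dk.
move=> /cvgrPdist_lt/(_ _ e0).
rewrite near_withinE; apply: filterS => t Ht.
have [->|t0] := eqVneq t 0; first by rewrite subrr mul0r subrr normr0 mulr0.
have := Ht t0; rewrite addr0 [_ *: 1]mulr1 -[_ *: _]/(_ * _) => H.
have -> : k t - k 0 - t * D = - (t * (D - t^-1 * (k t - k 0))) by field.
by rewrite normrN normrM mulrC ler_wpM2r// ltW.
Qed.

Section Subdifferentials.
Variables (R : realType) (n : nat).
Implicit Types (F psi : 'rV[R]_n -> \bar R) (phi : 'rV[R]_n -> R) (h e u v w x y : 'rV[R]_n).

Lemma differentiable_approx phi x (e : R) : differentiable phi x -> 0 < e ->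
  \forall y \near x, `|phi y - phi x - 'd phi x (y - x)| <= e * enorm (y - x).
Proof.
move=> /diff_locally/eqaddoP H e0; have {}H := H _ e0.
have : \forall y \near x, `|(phi \o shift x - (cst (phi x) + 'd phi x)) (y - x)|
   <= e * `|y - x|.
  by rewrite (near_shift 0) subr0; near=> z; rewrite /= addrK; near: z.
apply: filterS => y; rewrite !fctE /= subrK opprD addrA => /le_trans; apply.
by rewrite ler_wpM2l ?(ltW e0)// norm_le_enorm.
Unshelve. all: by end_near. Qed.

(** At [y = x] the inequality is trivial, so the punctured neighbourhoods of the lower limit become
    full ones. *)
Lemma frechet_subdiffP F x v : (forall y, F y != -oo%E) ->
  frechet_subdiff F x v <-> F x \is a fin_num /\ forall e : R, 0 < e ->
    \forall y \near x, (F x + (dotp v (y - x) - e * enorm (y - x))%:E <= F y)%E.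
Proof.
move=> FNy; rewrite /frechet_subdiff /=; set q := fun y => _.
have qE y (e : R) : F x \is a fin_num -> y != x -> ((- e)%:E <= q y)%E =
    (F x + (dotp v (y - x) - e * enorm (y - x))%:E <= F y)%E.
  move=> Fx yx; rewrite /q -(fineK Fx).
  have N0 : 0 < enorm (y - x) by rewrite enorm_gt0// subr_eq0.
  case: (F y) (FNy y) => [b| |]// _.
    rewrite -!EFinB -EFinM -EFinD !lee_fin ler_pdivlMr// mulNr.
    by apply/idP/idP; lra.
  by rewrite !addye// gt0_mulye ?leey// lte_fin invr_gt0.
split=> [[Fx L]|[Fx H]]; split => //.
  rewrite limf_einfE in L; move=> e e0.
  have : (- e%:E < ereal_sup [set ereal_inf (q @` V) | V in x^'])%E.
    by apply: lt_le_trans L; rewrite lteNl oppe0 lte_fin.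
  move=> /ereal_sup_gt[_ [V xV <-] eV].
  have : \forall y \near x, y != x -> V y by exact: xV.
  apply: filterS => y Vy.
  have [->|yx] := eqVneq y x.
    by rewrite subrr enorm0 dotpC dot0p mulr0 subr0 adde0.
  rewrite -qE// EFinN; apply: le_trans (ltW eV) _.
  by apply: ereal_inf_lbound; exists y => //; exact: Vy.
rewrite limf_einfE; apply/lee_addgt0Pr => e e0.
rewrite -leeBlDr// sub0e -EFinN.
pose V := [set y | y != x /\
  (F x + (dotp v (y - x) - e * enorm (y - x))%:E <= F y)%E].
apply: (@le_trans _ _ (ereal_inf (q @` V))).
  by apply: le_ereal_inf_tmp => _ [y [yx Hy] <-]; rewrite qE.
apply: ereal_sup_ubound; exists V => //.
by have := H e e0; apply: filterS => y Hy yx; split.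
Qed.

(* Convexity bounds [psi] along the segment from [u] to [y], so the Frechet inequality
   for [s + psi] near [u] propagates to [y] in the limit. *)
Lemma frechet_convex_subgrad psi (s : 'rV[R]_n -> R) (G : R) u w y :
  proper_efun psi -> econvex psi ->
  is_derive (0 : R) 1 (fun t => s (u + t *: (y - u))) G ->
  frechet_subdiff (fun z => (s z)%:E + psi z)%E u w ->
  (psi u + (dotp w (y - u) - G)%:E <= psi y)%E.
Proof.
move=> [psiN _] psic ds.
have FN z : ((s z)%:E + psi z != -oo)%E by case: (psi z) (psiN z).
move=> /(frechet_subdiffP _ _ FN)[].
case Eu : (psi u) (psiN u) => [a| |]// _ _ H.
case Ey : (psi y) (psiN y) => [b| |]// _; last by rewrite leey.
rewrite -EFinD lee_fin; set d := y - u in ds *.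
apply/ler_addgt0Pr => e e0.
have d1 : 0 < enorm d + 1 by rewrite ltr_wpDl ?enorm_ge0.
pose e1 := e / (2 * (enorm d + 1)).
have e10 : 0 < e1 by rewrite divr_gt0 ?mulr_gt0.
have e1E : e1 * (enorm d + 1) = e / 2 by rewrite /e1; field; rewrite gt_eqF.
have lim0 : (fun t : R => u + t *: d) @ 0 --> u.
  have : (fun t : R => u + t *: d) @ 0 --> u + (0 : R) *: d.
    by apply: cvgD; [exact: cvg_cst|apply: cvgZr_tmp; exact: cvg_id].
  by rewrite scale0r addr0.
have N1 : \forall t \near (0 : R)^'+, ((s u)%:E + a%:E +
    (dotp w (u + t *: d - u) - e1 * enorm (u + t *: d - u))%R%:E <=
    (s (u + t *: d)%R)%:E + psi (u + t *: d)%R)%E.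
  by apply: (@cvg_within _ (nbhs (0 : R))); exact: lim0 _ (H _ e10).
have N2 : \forall t \near (0 : R)^'+,
    `|s (u + t *: d) - s (u + 0 *: d) - t * G| <= e1 * `|t|.
  apply: (@cvg_within _ (nbhs (0 : R))).
  have N := is_derive_approx ds e10. exact: N.
have [t [[t0 t1] [A1 A2]]] := filter_ex (filterI
  (filterI (nbhs_right_gt (0 : R)) (nbhs_right_le ltr01)) (filterI N1 N2)).
move: A1 A2.
have ud : u + t *: d - u = t *: d by rewrite addrC addKr.
rewrite /= ud dotpZr enormZ gtr0_norm// scale0r addr0 => A1 A2.
have A3 : (psi (u + t *: d)%R <= ((1 - t) * a + t * b)%:E)%E.
  have := psic y u t; rewrite (ltW t0) t1 Eu Ey => /(_ isT).
  rewrite -!EFinM -EFinD; congr (psi _ <= _)%E; last by congr EFin; ring.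
  by rewrite /d scalerBr scalerBl scale1r addrCA addrA.
have := le_trans A1 (leeD2l (s (u + t *: d)%R)%:E A3).
rewrite -!EFinD lee_fin => A4.
have A5 := le_trans (ler_norm _) A2.
rewrite -(ler_pM2l t0).
move: A4 A5 e1E; rewrite /=; nra.
Qed.

(** Pass to the limit in [frechet_convex_subgrad] along the sequence defining the limiting
    subgradient: lower semicontinuity handles psi(u_k), and linearity in [e] upgrades the continuity
    of [G] for fixed [e] to convergence of [G (u k) (y - u k)]. *)
Lemma limiting_convex_subgrad psi (s : 'rV[R]_n -> R)
    (G : 'rV[R]_n -> 'rV[R]_n -> R) x v y :
  proper_efun psi -> econvex psi -> lower_semicontinuous psi ->
  (forall u e, is_derive (0 : R) 1 (fun t => s (u + t *: e)) (G u e)) ->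
  (forall u e, G u e = \sum_(a < n) e ord0 a * G u (delta_mx ord0 a)) ->
  (forall e, continuous (G ^~ e)) ->
  limiting_subdiff (fun z => (s z)%:E + psi z)%E x v ->
  (psi x + (dotp v (y - x) - G x (y - x))%:E <= psi y)%E.
Proof.
move=> ppsi psic psil ds Gl Gc [Fx [u [w [ux _ wv Hk]]]].
have [psiN _] := ppsi.
have S k : (psi (u k) + (dotp (w k) (y - u k) - G (u k) (y - u k))%R%:E <= psi y)%E :=
  frechet_convex_subgrad ppsi psic (ds _ _) (Hk k).
have [a Ex] : exists a, psi x = a%:E.
  by move: Fx (psiN x); case: (psi x) => // a _ _; exists a.
case Ey : (psi y) (psiN y) => [b| |]// _; last by rewrite leey.
rewrite Ex -EFinD lee_fin; apply/ler_addgt0Pr => e e0.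
have yu i : (fun k => (y - u k) ord0 i) @ \oo --> (y - x) ord0 i.
  have c1 := @coord_continuous R 1 n ord0 i (y - x).
  have yu0 : (fun k => y - u k) @ \oo --> y - x by apply: cvgB => //; exact: cvg_cst.
  exact: (cvg_comp _ _ yu0 c1).
have wk i : (fun k => w k ord0 i) @ \oo --> v ord0 i.
  exact: (cvg_comp _ _ wv (@coord_continuous R 1 n ord0 i v)).
have C1 : (fun k => dotp (w k) (y - u k)) @ \oo --> dotp v (y - x).
  by apply: cvg_sumr => i; apply: cvgM.
have C2 : (fun k => G (u k) (y - u k)) @ \oo --> G x (y - x).
  under eq_fun do rewrite Gl; rewrite Gl.
  apply: cvg_sumr => i; apply: cvgM => //.
  exact: (cvg_comp _ _ ux (@Gc _ x)).
have e2 : 0 < e / 2 by rewrite divr_gt0.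
have C3 : (fun k => dotp (w k) (y - u k) - G (u k) (y - u k)) @ \oo -->
    dotp v (y - x) - G x (y - x) by exact: cvgB C1 C2.
move/cvgrPdist_lt: C3 => /(_ _ e2) N1.
have [|V Vx HV] := psil x (a - e / 2); first by rewrite Ex lte_fin; lra.
have N2 := ux _ Vx.
have [k [K1 K2]] := filter_ex (filterI N1 N2).
have := S k; rewrite Ey; have := HV _ K2.
case: (psi (u k)) (psiN (u k)) => [c| |]// _.
rewrite lte_fin -EFinD lee_fin; move: K1; rewrite /= ltr_norml => /andP[]; lra.
Qed.

Lemma objective_frechet (f g : 'rV[R]_n -> R) psi x (xi w : 'rV[R]_n) :
  proper_efun psi -> psi x \is a fin_num ->
  (forall y, psi x + (dotp xi (y - x))%:E <= psi y)%E ->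
  differentiable f x -> differentiable g x ->
  (forall e, dotp w e = dotp xi e + 'd f x e - 'd g x e) ->
  frechet_subdiff (objective f psi g) x w.
Proof.
move=> [psiN _] psix S df dg wE; apply/frechet_subdiffP.
  by move=> y; rewrite /objective; case: (psi y) (psiN y).
split; first by rewrite /objective -(fineK psix).
move=> e e0; have e2 : 0 < e / 2 by rewrite divr_gt0.
apply: filterS (filterI (differentiable_approx df e2) (differentiable_approx dg e2)).
move=> y []; rewrite !ler_norml => /andP[F1 _] /andP[_ G1].
have := S y; rewrite /objective -(fineK psix).
case: (psi y) (psiN y) => [b| |]// _; last by move=> _; rewrite [X in (_ <= X - _)%E]addey// addye// leey.
rewrite -!EFinD !lee_fin wE; lra.
Qed.

End Subdifferentials.

(** * Topology of the limit set of a sequence with vanishing steps *)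

Section LimitPoints.
Variables (R : realType) (n : nat).
Implicit Types (B K D : set 'rV[R]_n) (x : nat -> 'rV[R]_n) (z b : 'rV[R]_n).

Lemma limit_pointsP x z : limit_points x z <->
  forall (e : R) (N : nat), 0 < e -> exists2 k, (N <= k)%N & enorm (x k - z) < e.
Proof.
split=> [xz e N e0|H A B [N _ HA] /nbhs_ballP[e /= e0 HB]].
  have xA : (x @ \oo) [set x k | k in [set k | (N <= k)%N]].
    by exists N => // k Nk; exists k.
  by have [_ [[k Nk <-]]] := xz _ _ xA (near_enorm_lt z e0); exists k.
have [k Nk xk] := H e N e0; exists (x k); split; first exact: HA.
apply: HB; rewrite -ball_normE /= distrC.
by apply: le_lt_trans xk; exact: norm_le_enorm.
Qed.

(** The limit point is one of a selected subsequence, so [P] can be kept along the iterates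
    approaching it. *)
Lemma compact_limit_point K x (P : nat -> Prop) : compact K ->
  (forall N, exists k, [/\ (N <= k)%N, K (x k) & P k]) ->
  exists2 z, K z & forall (e : R) (N : nat), 0 < e ->
    exists k, [/\ (N <= k)%N, P k & enorm (x k - z) < e].
Proof.
move=> cK /choice[s Hs].
have [|z [Kz /limit_pointsP zs]] := cK ((x \o s) @ \oo) _.
  by exists 0%N => // k _; have [] := Hs k.
exists z => // e N e0; have [k Nk xk] := zs e N e0.
by exists (s k); have [ks _ Pk] := Hs k; rewrite (leq_trans Nk ks).
Qed.

Lemma compact_enorm_ball (M : R) : compact [set z : 'rV[R]_n | enorm z <= M].
Proof.
apply: bounded_closed_compact.
  exists M; split; first exact: num_real.
  move=> M' MM' z /= zM; apply: le_trans (norm_le_enorm z) _.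
  by apply: le_trans zM _; exact: ltW.
apply: (@closed_comp _ _ (@enorm R n) [set t | t <= M]); last exact: closed_le.
by move=> z _; exact: enorm_continuous.
Qed.

Lemma bounded_enorm K : compact K -> exists M : R, forall z, K z -> enorm z <= M.
Proof.
move=> /compact_bounded[M [_ HM]]; exists (n%:R * (M + 1)) => z Kz.
apply: le_trans (enorm_le_norm z) _; rewrite ler_wpM2l//.
by apply: (HM _ _ z Kz); rewrite ltrDl.
Qed.

(* The annulus between radii [del / 2] and [del] around [B] contains no limit point, so
   [x] eventually avoids it; having short steps, [x] cannot jump across. *)
Lemma limit_points_trap x B (del : R) : 0 < del -> compact B ->
  (exists2 b, B b & limit_points x b) ->
  (forall e : R, 0 < e -> exists N, forall k, (N <= k)%N -> enorm (x k.+1 - x k) < e) ->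
  (forall z, limit_points x z -> (exists2 b, B b & enorm (z - b) < 2 * del) -> B z) ->
  exists N, forall k, (N <= k)%N -> exists2 b, B b & enorm (x k - b) < del.
Proof.
move=> d0 cB [b0 Bb0 /limit_pointsP xb0] steps sep.
have d20 : 0 < del / 2 by rewrite divr_gt0.
have [N1 HN1] := steps _ d20.
pose near (e : R) k := exists2 b, B b & enorm (x k - b) < e.
have [N2 HN2] : exists N2, forall k, (N2 <= k)%N -> near del k -> near (del / 2) k.
  apply: contrapT => H.
  have [M HM] := bounded_enorm cB.
  have ann N : exists k, [/\ (N <= k)%N, [set z | enorm z <= M + del] (x k) &
      near del k /\ ~ near (del / 2) k].
    apply: contrapT => H'; apply: H; exists N => k Nk nk.
    apply: contrapT => nk2; apply: H'; exists k; split => //.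
    have [b Bb xb] := nk; rewrite /= -[x k](subrK b).
    apply: le_trans (enormD _ _) _; have := HM b Bb; lra.
  have [z _ Hz] := compact_limit_point (@compact_enorm_ball _) ann.
  have zl : limit_points x z.
    by apply/limit_pointsP => e N e0; have [k [Nk _ kz]] := Hz e N e0; exists k.
  have Bz : B z.
    apply: sep => //; have [k [_ [[b Bb xb] _] xz]] := Hz del 0%N d0.
    exists b => //; apply: le_lt_trans (enorm_dist (x k) z b) _.
    by rewrite [enorm (z - _)]enormBC; lra.
  have [k [_ [_ nk] xz]] := Hz _ 0%N d20.
  by apply: nk; exists z.
have [k0 Nk0 k0b] := xb0 _ (maxn N1 N2) d20.
move: Nk0; rewrite geq_max => /andP[N1k0 N2k0].
have H k : near (del / 2) (k0 + k)%N.
  elim: k => [|k [b Bb IH]]; first by rewrite addn0; exists b0.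
  rewrite addnS; apply: HN2; first by rewrite (leq_trans N2k0)// -addnS leq_addr.
  exists b => //; apply: le_lt_trans (enorm_dist (x (k0 + k)%N) _ b) _.
  have := HN1 (k0 + k)%N (leq_trans N1k0 (leq_addr _ _)); lra.
exists k0 => k k0k; have [b Bb xb] := H (k - k0)%N.
by exists b => //; move: xb; rewrite subnKC//; lra.
Qed.

(** A nonempty relatively clopen part [B] is compact and lies at positive distance from the other
    limit points. The trap then keeps the sequence near [B], so no other limit point exists. *)
Lemma limit_points_connected x : compact (limit_points x) ->
  (forall e : R, 0 < e -> exists N, forall k, (N <= k)%N -> enorm (x k.+1 - x k) < e) ->
  connected (limit_points x).
Proof.
move=> cO steps B [b0 Bb0] [C oC BC] [D cD BD].
have cB : compact B by rewrite BD; exact: compact_closedI.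
(* Otherwise limit points outside [B] come arbitrarily close to [B]; by compactness they accumulate
   at some [b] in [B] and enter the open set [C], which puts them in [B]. *)
have [del d0 sep] : exists2 del : R, 0 < del &
    forall z, limit_points x z -> (exists2 b, B b & enorm (z - b) < 2 * del) -> B z.
  apply: contrapT => H.
  have Hm (m : nat) : exists zb : 'rV[R]_n * 'rV[R]_n,
      [/\ limit_points x zb.1, ~ B zb.1, B zb.2 & enorm (zb.1 - zb.2) < 2 * m.+1%:R^-1].
    apply: contrapT => H'; apply: H; exists m.+1%:R^-1; first by rewrite invr_gt0.
    move=> z zl [b Bb zb]; apply: contrapT => nBz; apply: H'.
    by exists (z, b).
  have [zb Hzb] := choice Hm.
  have [|b Bb Hb] := @compact_limit_point B (fun m => (zb m).2) (fun=> True) cB.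
    by move=> N; exists N; have [] := Hzb N.
  have Cb : C b by move: Bb; rewrite BC => -[].
  have /nbhs_ballP[e /= e0 HC] := open_nbhs_nbhs (conj oC Cb).
  have e20 : 0 < e / 2 by rewrite divr_gt0.
  have [N HN] : exists N : nat, 2 * N.+1%:R^-1 < e / 2 :> R.
    have e40 : 0 < e / 4 by rewrite divr_gt0.
    have [N _ HN] := near_infty_natSinv_lt (PosNum e40); exists N.
    have HN' : N.+1%:R^-1 < e / 4 := HN N (leqnn _).
    by move: (N.+1%:R^-1) HN' => q Hq; lra.
  have [m [Nm _ mb]] := Hb _ N e20.
  have [zl nB _ zbm] := Hzb m.
  apply: nB; rewrite BC; split => //; apply: HC.
  rewrite -ball_normE /= distrC; apply: le_lt_trans (norm_le_enorm _) _.
  apply: le_lt_trans (enorm_dist (zb m).2 _ b) _.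
  rewrite [ltRHS]splitr; apply: ltrD => //; apply: lt_trans HN.
  by apply: lt_le_trans zbm _; rewrite ler_pM2l// lef_pV2 ?posrE// ler_nat.
have xb0 : limit_points x b0 by move: Bb0; rewrite BC => -[].
have [|N HN] := limit_points_trap d0 cB _ steps sep; first by exists b0.
apply/seteqP; split; first by rewrite BC => z [].
move=> z zl; apply: sep => //.
have [k Nk kz] := (limit_pointsP x z).1 zl del N d0.
have [b Bb kb] := HN k Nk; exists b => //.
apply: le_lt_trans (enorm_dist (x k) z b) _.
by rewrite [enorm (z - _)]enormBC; lra.
Qed.

End LimitPoints.

(** * Real sequences: from descent and the KL inequality to rates *)

Section Rates.
Variable R : realType.
Implicit Types (a b c d C K r kappa : R).

(** The tangent inequality of the concave function t^kappa at [a], multiplied by a^(1-kappa) so that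
    it includes a = 0. Expanded, it is Young's inequality b^kappa a^(1-kappa) <= kappa b + (1-kappa)
    a. *)
Lemma powR_concave a b kappa : 0 <= a -> 0 <= b -> 0 < kappa < 1 ->
  kappa * (a - b) <= a `^ (1 - kappa) * (a `^ kappa - b `^ kappa).
Proof.
move=> a0 b0 /andP[k0 k1]; have k1' : 0 < 1 - kappa by rewrite subr_gt0.
have H := @conjugate_powR R (b `^ kappa) (a `^ (1 - kappa)) kappa^-1 (1 - kappa)^-1
  (powR_ge0 _ _) (powR_ge0 _ _).
rewrite !invr_gt0 !invrK -!powRrM !mulfV ?gt_eqF// !powRr1// in H.
have sum1 : kappa + (1 - kappa) = 1 by rewrite addrC subrK.
have {}H := H k0 k1' sum1.
have E : a `^ (1 - kappa) * a `^ kappa = a.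
  have s1 : 1 - kappa + kappa = 1 by rewrite subrK.
  by rewrite -powRD s1 ?powRr1// oner_eq0.
rewrite [leRHS]mulrBr E [X in _ <= _ - X]mulrC; move: H; lra.
Qed.

(** Either a <= b/2, or b < 2a and a^s can be cancelled. *)
Lemma absorb_step a b D (s : nat) : 0 <= a -> 0 <= b -> 0 <= D ->
  a ^+ s.+1 <= b ^+ s * D -> a <= b / 2 + 2 ^+ s * D.
Proof.
move=> a0 b0 D0 H; have [ab|ba] := leP a (b / 2).
  by apply: le_trans ab _; rewrite lerDl mulr_ge0// exprn_ge0.
have a1 : 0 < a by apply: le_lt_trans ba; rewrite divr_ge0.
apply: le_trans (_ : 2 ^+ s * D <= _); last by rewrite lerDr divr_ge0.
rewrite -(ler_pM2l (exprn_gt0 s a1)) -exprSr; apply: le_trans H _.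
rewrite mulrA -exprMn ler_wpM2r// lerXn2r ?nnegrE ?mulr_ge0//.
by move: ba; rewrite ltr_pdivrMr// => /ltW.
Qed.

(** [d] is the step length, [A] the gap to the limit value, [s] = min(p,q). The energy [E] turns
    both hypotheses into one recursion, and its decrements dominate the steps, so it bounds the tail
    of the trajectory. *)
Lemma KL_energy (d A : nat -> R) r c C (s N : nat) :
  (forall k, 0 <= d k) -> (forall k, 0 <= A k) -> 1 < r -> 0 < c -> 0 < C ->
  (0 < s)%N ->
  (forall k, (N <= k)%N -> d k <= 1) ->
  (forall k, (N <= k)%N -> c * d k ^+ s.+1 <= A k - A k.+1) ->
  (forall k, (N <= k)%N -> A k.+1 <= C * (d k ^+ s) `^ r) ->
  exists E : nat -> R, exists2 K, 0 < K &
    forall k, (N < k)%N -> [/\ 0 <= E k, d k <= E k - E k.+1 &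
      E k.+1 <= K * (E k - E k.+1) `^ Num.min 1 ((r - 1) * s%:R)].
Proof.
move=> d0 A0 r1 c0 C0 s0 d1 desc KL.
have r0 : 0 < r by apply: lt_trans r1.
pose ka := 1 - r^-1.
have ka01 : 0 < ka < 1.
  by rewrite subr_gt0 invf_lt1// r1 gtrBl invr_gt0.
have [ka0 _] := andP ka01.
pose phi k := A k `^ ka.
pose K1 := C `^ r^-1 / (ka * c).
have K10 : 0 < K1 by rewrite divr_gt0 ?powR_gt0// mulr_gt0.
pose K := 2 ^+ s * K1.
have K0 : 0 < K by rewrite mulr_gt0// exprn_gt0.
have phi_decr k : (N <= k)%N -> phi k.+1 <= phi k.
  move=> Nk; apply: ge0_ler_powR; rewrite ?nnegrE// ?(ltW ka0)//.
  rewrite -subr_ge0; apply: le_trans (desc k Nk).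
  by rewrite mulr_ge0 ?(ltW c0)// exprn_ge0.
have Aroot k : (N <= k)%N -> A k.+1 `^ r^-1 <= C `^ r^-1 * d k ^+ s.
  move=> Nk; have := ge0_ler_powR (_ : 0 <= r^-1) _ _ (KL k Nk).
  rewrite invr_ge0 (ltW r0) !nnegrE A0 mulr_ge0 ?powR_ge0 ?(ltW C0)//.
  move=> /(_ isT isT isT); rewrite powRM ?powR_ge0 ?(ltW C0)//.
  by rewrite -powRrM mulfV ?gt_eqF// powRr1// exprn_ge0.
(* KL at the previous index bounds A_k^(1/r) by a multiple of d_{k-1}^s. With concavity and descent
   this gives d_k^(s+1) <= d_{k-1}^s K1 (phi_k - phi_{k+1}), ready for [absorb_step]. *)
have step k : (N < k)%N -> d k <= d k.-1 / 2 + K * (phi k - phi k.+1).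
  case: k => // k; rewrite ltnS /= => Nk; have Nk1 : (N <= k.+1)%N by exact: ltnW.
  rewrite /K -mulrA; apply: absorb_step => //.
    by rewrite mulr_ge0 ?(ltW K10)// subr_ge0 phi_decr.
  have H1 := powR_concave (A0 k.+1) (A0 k.+2) ka01.
  have H2 : A k.+1 `^ (1 - ka) <= C `^ r^-1 * d k ^+ s.
    by rewrite /ka opprB addrC subrK Aroot.
  have H3 := ler_wpM2r (_ : 0 <= phi k.+1 - phi k.+2) H2.
  have {}H3 := le_trans H1 (H3 (_ : is_true _)).
  rewrite subr_ge0 phi_decr// in H3; have {}H3 := H3 isT.
  rewrite -(ler_pM2l (mulr_gt0 ka0 c0)) -mulrA.
  apply: le_trans (_ : ka * (A k.+1 - A k.+2) <= _).
    by rewrite ler_pM2l// desc.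
  apply: (le_trans H3); rewrite /K1 le_eqVlt; apply/orP; left; apply/eqP.
  by field; rewrite !gt_eqF.
(* Doubling [step] and moving one d_k to the other side gives d_k <= E_k - E_{k+1}. *)
pose E k := d k.-1 + 2 * K * phi k.
have K2 : 0 <= 2 * K * C `^ ka.
  by apply: mulr_ge0 (powR_ge0 _ _); apply: mulr_ge0 => //; exact: ltW.
exists E, (1 + 2 * K * C `^ ka); first by rewrite ltr_pwDl.
move=> k Nk; have Nk' := ltnW Nk.
have Ed : d k <= E k - E k.+1.
  by have := step k Nk; rewrite /E /=; lra.
split => //.
  by rewrite addr_ge0// mulr_ge0 ?powR_ge0// mulr_ge0// ltW.
set th := Num.min _ _.
have th0 : 0 <= th by rewrite le_min ler01 mulr_ge0// subr_ge0 ltW.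
apply: le_trans (_ : (1 + 2 * K * C `^ ka) * d k `^ th <= _); last first.
  rewrite ler_wpM2l ?addr_ge0//.
  by apply: ge0_ler_powR; rewrite ?nnegrE// (le_trans (d0 k) Ed).
have [dk0|dk0] := eqVneq (d k) 0.
  have Ak0 : A k.+1 = 0.
    apply/eqP; rewrite eq_le A0 andbT; apply: le_trans (KL k Nk') _.
    by rewrite dk0 expr0n gtn_eqF// powR0 ?gt_eqF// mulr0.
  rewrite /E /= /phi dk0 Ak0 powR0 ?gt_eqF// mulr0 addr0.
  by rewrite mulr_ge0 ?powR_ge0// addr_ge0.
have dk : 0 < d k <= 1 by rewrite lt_neqAle eq_sym dk0 d0 d1.
have H1 : d k <= d k `^ th.
  by rewrite ger1_powR// ge_min lexx.
(* The exponent s r (1 - 1/r) equals (r - 1)s; since d_k <= 1 it may be lowered to [th]. *)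
have H2 : phi k.+1 <= C `^ ka * d k `^ th.
  have := ge0_ler_powR (ltW ka0) _ _ (KL k Nk').
  rewrite !nnegrE A0 mulr_ge0 ?powR_ge0 ?(ltW C0)// => /(_ isT isT)/le_trans; apply.
  rewrite powRM ?powR_ge0 ?(ltW C0)// ler_wpM2l ?powR_ge0//.
  rewrite -powR_mulrn// -!powRrM.
  apply: ger_powR => //.
  rewrite ge_min; apply/orP; right; rewrite le_eqVlt; apply/orP; left; apply/eqP.
  by rewrite /ka; field; rewrite gt_eqF.
have K20 : 0 <= 2 * K by rewrite mulr_ge0// ltW.
by rewrite /E /=; have := ler_wpM2l K20 H2; move: H1; lra.
Qed.

Lemma energy_linear_rate (E : nat -> R) K (N : nat) : 0 < K ->
  (forall k, (N <= k)%N -> 0 <= E k) ->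
  (forall k, (N <= k)%N -> E k.+1 <= K * (E k - E k.+1)) ->
  exists c tau, [/\ 0 < c, 0 < tau < 1 &
    forall k, (N <= k)%N -> E k <= c * tau ^+ k].
Proof.
move=> K0 E0 H; pose tau := K / (1 + K).
have K1 : 0 < 1 + K by rewrite addr_gt0.
have tau0 : 0 < tau by rewrite divr_gt0.
(* The [+ 1] keeps the constant positive when [E N = 0]. *)
exists ((E N + 1) / tau ^+ N), tau; split.
- by rewrite divr_gt0 ?exprn_gt0// ltr_wpDl// E0.
- by rewrite tau0 ltr_pdivrMr// mul1r ltrDr ltr01.
elim=> [|k IH].
  by rewrite leqn0 => /eqP N0; rewrite N0 !expr0 divr1 mulr1 lerDl.
rewrite leq_eqVlt => /predU1P[<-|Nk].
  by rewrite divfK ?gt_eqF ?exprn_gt0// lerDl.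
have := H k Nk; have := IH Nk => IHk Hk.
have E1 : E k.+1 <= tau * E k.
  by rewrite /tau mulrAC ler_pdivlMr//; move: Hk; lra.
apply: (le_trans E1); rewrite exprS mulrCA ler_pM2l//.
Qed.

(** The recursion says that G_{k+1} <= E_k - E_{k+1} for the nonincreasing G = (E/K)^(1/kappa).
    Telescoping yields k G_{N+k} <= E_N, and beyond 2N the shift costs only a factor 2. *)
Lemma energy_sublinear_rate (E : nat -> R) K kappa (N : nat) : 0 < K -> 0 < kappa ->
  (forall k, (N <= k)%N -> 0 <= E k) ->
  (forall k, (N <= k)%N -> E k.+1 <= E k) ->
  (forall k, (N <= k)%N -> E k.+1 <= K * (E k - E k.+1) `^ kappa) ->
  exists2 c, 0 < c & forall k, (N.*2 < k)%N -> E k <= c * k%:R `^ (- kappa).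
Proof.
move=> K0 ka0 E0 Edecr H.
pose G k := (E k / K) `^ kappa^-1.
have ik0 : 0 <= kappa^-1 by rewrite invr_ge0 ltW.
have G1 k : (N <= k)%N -> G k.+1 <= E k - E k.+1.
  move=> Nk; have D0 : 0 <= E k - E k.+1 by rewrite subr_ge0 Edecr.
  have Nk1 := leqW Nk.
  have := ge0_ler_powR ik0 _ _ (_ : E k.+1 / K <= (E k - E k.+1) `^ kappa).
  rewrite !nnegrE powR_ge0 divr_ge0 ?E0 ?(ltW K0)// => /(_ isT isT).
  rewrite ler_pdivrMr// mulrC H// => /(_ isT)/le_trans; apply.
  by rewrite -powRrM mulfV ?gt_eqF// powRr1.
have G2 k : (N <= k)%N -> G k.+1 <= G k.
  move=> Nk; have Nk1 := leqW Nk.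
  apply: ge0_ler_powR; rewrite ?nnegrE ?divr_ge0 ?E0 ?(ltW K0)//.
  by rewrite ler_wpM2r ?invr_ge0 ?(ltW K0)// Edecr.
have S k : (k%:R * G (N + k)%N <= E N - E (N + k)%N).
  elim: k => [|k IH]; first by rewrite mul0r addn0 subrr.
  have Nk := leq_addr k N.
  rewrite addnS -natr1; have := G1 _ Nk; have := G2 _ Nk.
  have := ler_wpM2l (ler0n R k) (G2 _ Nk); lra.
pose c := K * (2 * (E N + 1)) `^ kappa.
have EN1 : 0 < E N + 1 by rewrite ltr_wpDl// E0.
exists c; first by rewrite mulr_gt0// powR_gt0// mulr_gt0.
move=> k Nk.
have NleK : (N <= k)%N by rewrite (leq_trans _ (ltnW Nk))// -addnn leq_addr.
have k0 : 0 < k%:R :> R by rewrite ltr0n; case: (k) Nk.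
have half : k%:R <= 2 * (k - N)%:R :> R.
  rewrite -natrM ler_nat mul2n doubleB leq_subRL ?leq_double//.
  by rewrite -[leqRHS]addnn leq_add2r ltnW.
have key : G k <= 2 * (E N + 1) / k%:R.
  rewrite ler_pdivlMr//.
  have := S (k - N)%N; rewrite subnKC// => Sk.
  have Gk0 : 0 <= G k by exact: powR_ge0.
  have := ler_wpM2l Gk0 half; have := E0 _ NleK; lra.
have EG : E k = K * G k `^ kappa.
  rewrite -powRrM mulVf ?gt_eqF// powRr1 ?divr_ge0 ?E0 ?(ltW K0)//.
  by rewrite mulrC divfK ?gt_eqF.
rewrite EG /c -mulrA ler_wpM2l ?(ltW K0)//.
rewrite powRN -[X in _ * X]powR_inv1 ?powR_ge0// -powRrM mulrN1 -mulN1r powRrM.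
rewrite powR_inv1 ?ler0n// -powRM ?invr_ge0 ?ler0n ?mulr_ge0 ?(ltW EN1)//.
by apply: ge0_ler_powR; rewrite ?nnegrE ?powR_ge0 ?divr_ge0 ?mulr_ge0 ?(ltW EN1) ?(ltW ka0).
Qed.

End Rates.

Lemma nonincreasing_inf_limit (R : realType) (F : nat -> R) (b : R) :
  (forall k, b <= F k) -> (forall k, F k.+1 <= F k) ->
  exists l : R, (forall k, l <= F k) /\
    forall e : R, 0 < e -> exists N, forall k, (N <= k)%N -> F k < l + e.
Proof.
move=> Fb decr; pose E := range F.
have lE : has_lbound E by exists b => _ [k _ <-].
have hE : has_inf E by split => //; exists (F 0%N); exists 0%N.
exists (inf E); split=> [k|e e0]; first by apply: ge_inf => //; exists k.
have [_ [N _ <-] HN] := inf_adherent e0 hE.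
exists N => k /subnKC <-; apply: le_lt_trans HN.
by elim: (k - N)%N => [|j IH]; rewrite ?addn0// addnS; exact: le_trans IH.
Qed.

(** * Gradient of the smooth part of the model *)

Section ModelGradient.
Variables (R : realType) (n : nat).
Implicit Types (U D : set 'rV[R]_n) (phi f g : 'rV[R]_n -> R) (e u v w x y : 'rV[R]_n)
  (psi : 'rV[R]_n -> \bar R).

Lemma dotp_delta v (a : 'I_n) : dotp v (delta_mx ord0 a) = v ord0 a.
Proof.
rewrite /dotp (bigD1 a)//= mxE !eqxx mulr1 big1 ?addr0// => i ia.
by rewrite mxE (negbTE ia) andbF mulr0.
Qed.

Lemma dotp_coord v e : dotp v e = \sum_(a < n) e ord0 a * dotp v (delta_mx ord0 a).
Proof. by apply: eq_bigr => a _; rewrite dotp_delta mulrC. Qed.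

Lemma riesz_row (l : 'rV[R]_n -> R) :
  (forall e, l e = \sum_(a < n) e ord0 a * l (delta_mx ord0 a)) ->
  exists w, forall e, dotp w e = l e.
Proof.
move=> lE; exists (\row_a l (delta_mx ord0 a)) => e.
by rewrite lE; apply: eq_bigr => a _; rewrite mxE mulrC.
Qed.

Lemma enorm_le_dual w (C : R) : 0 <= C ->
  (forall e, `|dotp w e| <= C * enorm e) -> enorm w <= C.
Proof.
move=> C0 H; have [->|w0] := eqVneq w 0; first by rewrite enorm0.
have wp := enorm_gt0 w0.
by have := H w; rewrite ger0_norm ?dotpp_ge0// -enorm_sqr expr2 ler_pM2r.
Qed.

Definition smooth_model p q f g (Mp Mq : R) x u : R :=
  (taylor p f u x + Mp / p.+1`!%:R * enorm (u - x) ^+ p.+1) +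
  (- taylor q g u x + Mq / q.+1`!%:R * enorm (u - x) ^+ q.+1).

(* Derivative in the direction [e] of [u |-> M / (p.+1)! * |u - x| ^ p.+1]. *)
Definition dreg p (M : R) x u e : R :=
  M / p.+1`!%:R * (p.+1%:R * enorm (u - x) ^+ p.-1 * dotp (u - x) e).

Definition dsmooth_model p q f g (Mp Mq : R) x u e : R :=
  (dtaylor p f u x e + dreg p Mp x u e) + (- dtaylor q g u x e + dreg q Mq x u e).

Lemma modelE p q f g psi (Mp Mq : R) x y :
  model p q f psi g Mp Mq y x = ((smooth_model p q f g Mp Mq x y)%:E + psi y)%E.
Proof. by rewrite /model addeAC -EFinD. Qed.

Lemma is_derive_reg p (M : R) x u e : (0 < p)%N ->
  is_derive (0 : R) 1 (fun t => M / p.+1`!%:R * enorm (u + t *: e - x) ^+ p.+1)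
    (dreg p M x u e).
Proof.
move=> p0; have d := is_derive_enormX (u - x) e p0.
rewrite (_ : (fun t => _) = (M / p.+1`!%:R) *: (fun t : R => enorm (u - x + t *: e) ^+ p.+1)).
  exact: is_deriveZ.
by apply/funext => t; rewrite addrAC.
Qed.

Lemma is_derive_smooth_model Uf Ug p q f g (Mp Mq : R) x u e :
  open Uf -> open Ug -> Ck Uf p f -> Ck Ug q g -> Uf x -> Ug x ->
  (0 < p)%N -> (0 < q)%N ->
  is_derive (0 : R) 1 (fun t => smooth_model p q f g Mp Mq x (u + t *: e))
    (dsmooth_model p q f g Mp Mq x u e).
Proof.
move=> oUf oUg Cf Cg Ux Vx p0 q0.
have d1 := is_derive_taylor u e oUf Cf Ux.
have d2 := is_derive_taylor u e oUg Cg Vx.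
have r1 := is_derive_reg Mp x u e p0.
have r2 := is_derive_reg Mq x u e q0.
exact: (is_deriveD (is_deriveD d1 r1) (is_deriveD (is_deriveN d2) r2)).
Qed.

Lemma dreg_coord p (M : R) x u e :
  dreg p M x u e = \sum_(a < n) e ord0 a * dreg p M x u (delta_mx ord0 a).
Proof.
rewrite /dreg [dotp _ e]dotp_coord !mulr_sumr; apply: eq_bigr => a _; ring.
Qed.

Lemma dsmooth_model_coord Uf Ug p q f g (Mp Mq : R) x u e :
  open Uf -> open Ug -> Ck Uf p f -> Ck Ug q g -> Uf x -> Ug x ->
  dsmooth_model p q f g Mp Mq x u e =
  \sum_(a < n) e ord0 a * dsmooth_model p q f g Mp Mq x u (delta_mx ord0 a).
Proof.
move=> oUf oUg Cf Cg Ux Vx; rewrite /dsmooth_model.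
rewrite (dtaylor_coord _ _ oUf Cf Ux) (dtaylor_coord _ _ oUg Cg Vx).
rewrite !(dreg_coord _ _ _ _ e) -sumrN -!big_split /=.
by apply: eq_bigr => a _; ring.
Qed.

Lemma dreg_continuous p (M : R) x e : continuous (fun u => dreg p M x u e).
Proof.
move=> u.
have s : {for u, continuous (fun u : 'rV[R]_n => u - x)}.
  by apply: continuousB; [exact: id|exact: cst_continuous].
have c1 : {for u, continuous (fun u : 'rV[R]_n => enorm (u - x))}.
  exact: (continuous_comp s (@enorm_continuous R n _)).
have c2 : {for u, continuous (fun u : 'rV[R]_n => enorm (u - x) ^+ p.-1)}.
  exact: (continuous_comp c1 (@exprn_continuous R p.-1 _)).
have c3 : {for u, continuous (fun u : 'rV[R]_n => dotp (u - x) e)}.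
  exact: (continuous_comp s (@dotp_continuous R n e _)).
apply: (continuousM (@cst_continuous _ _ (M / p.+1`!%:R) u)).
by apply: (continuousM _ c3); apply: (continuousM _ c2); exact: cst_continuous.
Qed.

Lemma dsmooth_model_continuous Uf Ug p q f g (Mp Mq : R) x e :
  open Uf -> open Ug -> Ck Uf p f -> Ck Ug q g -> Uf x -> Ug x ->
  continuous (fun u => dsmooth_model p q f g Mp Mq x u e).
Proof.
move=> oUf oUg Cf Cg Ux Vx u.
have c1 := @dtaylor_continuous _ _ _ _ _ _ e oUf Cf Ux u.
have c2 := @dtaylor_continuous _ _ _ _ _ _ e oUg Cg Vx u.
have r1 := @dreg_continuous p Mp x e u.
have r2 := @dreg_continuous q Mq x e u.
exact: (continuousD (continuousD c1 r1) (continuousD (continuousN c2) r2)).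
Qed.

Lemma dreg_le p (M : R) x u e : (0 < p)%N ->
  `|dreg p M x u e| <= `|M| / p`!%:R * enorm (u - x) ^+ p * enorm e.
Proof.
move=> p0; rewrite /dreg !normrM factS natrM.
rewrite (ger0_norm (ler0n _ _)) normfV [`|_ * _%:R|]ger0_norm ?mulr_ge0//.
rewrite [`|_ ^+ _|]ger0_norm ?exprn_ge0 ?enorm_ge0//.
have -> : enorm (u - x) ^+ p = enorm (u - x) ^+ p.-1 * enorm (u - x).
  by rewrite -exprSr prednK.
have fp : p`!%:R != 0 :> R by rewrite pnatr_eq0 -lt0n fact_gt0.
have p1 : 1 + p%:R != 0 :> R by rewrite addrC natr1 pnatr_eq0.
apply: (@le_trans _ _ (`|M| / p`!%:R * (enorm (u - x) ^+ p.-1 * `|dotp (u - x) e|))).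
  by rewrite le_eqVlt; apply/orP; left; apply/eqP; field; rewrite fp p1.
rewrite -!mulrA !ler_wpM2l ?invr_ge0 ?exprn_ge0 ?enorm_ge0//.
exact: dotp_le.
Qed.

(** The gradient stays bounded near [z] while [z - y] tends to 0; used in [limit_value]. *)
Lemma Dd_cvg0 U p phi z : open U -> (0 < p)%N -> Ck U p phi -> U z ->
  (fun y => Dd (z - y) phi y) @ z --> (0 : R).
Proof.
move=> oU p0 C Uz.
have [_ C1] : Ck U 1 phi by exact: Ck_le C.
have -> : (fun y => Dd (z - y) phi y) =
    (fun y => \sum_(a < n) (z - y) ord0 a * Dd (delta_mx ord0 a) phi y).
  by apply/funext => y; exact: Dd_coord.
rewrite -[X in _ --> X](_ : \sum_(a < n) (z - z) ord0 a * Dd (delta_mx ord0 a) phi z = 0).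
  have zz : {for z, continuous (fun y : 'rV[R]_n => z - y)}.
    by apply: continuousB; [exact: cst_continuous|exact: id].
  apply: (@cvg_sumr _ _ _ (nbhs z) _) => a.
  exact: (continuousM (continuous_comp zz (@coord_continuous R 1 n ord0 a _)) (C1 _ z Uz)).
by rewrite big1// => a _; rewrite subrr mxE mul0r.
Qed.

Lemma frechet_limiting (F : 'rV[R]_n -> \bar R) x w :
  F x \is a fin_num -> frechet_subdiff F x w -> limiting_subdiff F x w.
Proof.
move=> Fx H; split => //; exists (fun=> x), (fun=> w).
by split => //; exact: cvg_cst.
Qed.

End ModelGradient.

(** * The iterates of the algorithm *)

Section HigherOrderDC.
Variables (R : realType) (n p q : nat) (f g : 'rV[R]_n -> R)
  (psi : 'rV[R]_n -> \bar R) (Lpf Lqg Mp Mq : R) (x : nat -> 'rV[R]_n)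
  (Uf Ug : set 'rV[R]_n).
Hypotheses (p0 : (0 < p)%N) (q0 : (0 < q)%N)
  (oUf : open Uf) (oUg : open Ug) (DUf : dom psi `<=` Uf) (DUg : dom psi `<=` Ug)
  (Cf : Ck Uf p f) (Cg : Ck Ug q g) (Lpf0 : 0 < Lpf) (Lqg0 : 0 < Lqg)
  (lipf : lipschitz_D (dom psi) p f Lpf) (lipg : lipschitz_D (dom psi) q g Lqg)
  (psi_proper : proper_efun psi) (psi_lsc : lower_semicontinuous psi)
  (psi_convex : econvex psi) (dom_closed : closed (dom psi))
  (xHO : HO_DC p q f psi g Lpf Lqg Mp Mq x).

Let F := objective f psi g.
Let d k := enorm (x k.+1 - x k).
(** The real value of F along the iterates; [fine] loses nothing, as they stay in [dom psi] by
    [HO_DC_dom]. *)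
Let Fr k := f (x k) + fine (psi (x k)) - g (x k).

Let psi_dom y : dom psi y -> psi y = (fine (psi y))%:E.
Proof.
move=> Dy; rewrite fineK//; have [psiN _] := psi_proper.
by rewrite fin_numE psiN lt_eqF.
Qed.

Let F_dom y : dom psi y -> F y = (f y + fine (psi y) - g y)%:E.
Proof. by move=> /psi_dom E; rewrite /F /objective E. Qed.

Lemma segment_closed_dom : segment_closed (dom psi).
Proof.
move=> y z t Dy Dz t01.
have := psi_convex z y t01; rewrite (psi_dom Dy) (psi_dom Dz).
rewrite (_ : t *: z + (1 - t) *: y = y + t *: (z - y)); last first.
  by rewrite scalerBr scalerBl scale1r addrCA.
by rewrite /dom /= => /le_lt_trans; apply; rewrite -!EFinM -EFinD ltry.
Qed.

Let model_dom y z : dom psi z -> model p q f psi g Mp Mq z y =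
  (smooth_model p q f g Mp Mq y z + fine (psi z))%:E.
Proof. by move=> /psi_dom E; rewrite modelE E. Qed.

Let taylor_xx r phi U y : open U -> dom psi `<=` U -> (0 < r)%N -> Ck U r phi ->
  (exists L, lipschitz_D (dom psi) r phi L) -> dom psi y -> taylor r phi y y = phi y.
Proof.
move=> oU DU r0 C [L lip] Dy.
have := taylor_remainder oU DU segment_closed_dom r0 C lip Dy Dy.
rewrite subrr enorm0 expr0n mulr0 normr_le0 subr_eq0 => /eqP //.
Qed.

Lemma HO_DC_dom k : dom psi (x k).
Proof.
have [_ _ x0 H] := xHO; elim: k => [//|k IH].
have [_] := H k; rewrite (model_dom _ IH) modelE /dom /=.
by case: (psi (x k.+1)) => [r _||_]; rewrite ?ltry ?ltNyr// addey.
Qed.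

(** The upper Taylor bound for [f] and the lower one for [g] make the model exceed F at x_{k+1} by
    this amount, and the model at x_{k+1} is at most F(x_k). *)
Lemma objective_decrease k :
  (Mp - Lpf) / p.+1`!%:R * d k ^+ p.+1 + (Mq - Lqg) / q.+1`!%:R * d k ^+ q.+1 <=
  Fr k - Fr k.+1.
Proof.
have [_ _ _ H] := xHO; have [_] := H k.
have Dk := HO_DC_dom k; have Dk1 := HO_DC_dom k.+1.
rewrite !model_dom// lee_fin /smooth_model subrr enorm0 !expr0n !mulr0.
rewrite (taylor_xx oUf DUf p0 Cf _ Dk); last by exists Lpf.
rewrite (taylor_xx oUg DUg q0 Cg _ Dk); last by exists Lqg.
have := taylor_remainder oUf DUf segment_closed_dom p0 Cf lipf Dk Dk1.
have := taylor_remainder oUg DUg segment_closed_dom q0 Cg lipg Dk Dk1.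
rewrite !ler_norml => /andP[H1 _] /andP[_ H2] H3.
rewrite /Fr /d; move: H1 H2 H3; rewrite !(mulrBl _ Mp) !(mulrBl _ Mq) !mulrBl; lra.
Qed.

Lemma next_stationary k y :
  (psi (x k.+1) + (- dsmooth_model p q f g Mp Mq (x k) (x k.+1) (y - x k.+1))%:E
   <= psi y)%E.
Proof.
have [_ _ _ H] := xHO; have [Hk _] := H k.
have Ux := DUf (HO_DC_dom k); have Vx := DUg (HO_DC_dom k).
have {}Hk : limiting_subdiff
    (fun z => (smooth_model p q f g Mp Mq (x k) z)%:E + psi z)%E (x k.+1) 0.
  by move: Hk; congr (limiting_subdiff _ _ _); apply/funext => z; rewrite modelE.
have := @limiting_convex_subgrad _ _ psi _ (dsmooth_model p q f g Mp Mq (x k))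
  _ _ y psi_proper psi_convex psi_lsc _ _ _ Hk.
rewrite dot0p sub0r; apply.
- by move=> u e; apply: (@is_derive_smooth_model _ _ Uf Ug).
- by move=> u e; apply: (@dsmooth_model_coord _ _ Uf Ug).
- by move=> e; apply: (@dsmooth_model_continuous _ _ Uf Ug).
Qed.

(** [w] is grad f - grad g plus the subgradient of psi from [next_stationary]: a difference of true
    and Taylor gradients, controlled by [taylor_grad], and regularization terms, controlled by
    [dreg_le]. *)
Lemma small_subgradient : exists2 C : R, 0 < C & forall k, exists w,
  [/\ frechet_subdiff F (x k.+1) w,
      forall e, dotp w e = Dd e f (x k.+1) - Dd e g (x k.+1) -
        dsmooth_model p q f g Mp Mq (x k) (x k.+1) e &
      enorm w <= C * (d k ^+ p + d k ^+ q)].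
Proof.
have [C1 C10 H1] := taylor_grad R n p; have [C2 C20 H2] := taylor_grad R n q.
pose B1 := C1 * Lpf + `|Mp| / p`!%:R; pose B2 := C2 * Lqg + `|Mq| / q`!%:R.
have B10 : 0 <= B1 by rewrite addr_ge0 ?mulr_ge0 ?divr_ge0 ?(ltW Lpf0).
have B20 : 0 <= B2 by rewrite addr_ge0 ?mulr_ge0 ?divr_ge0 ?(ltW Lqg0).
exists (B1 + B2 + 1) => [|k]; first by rewrite ltr_wpDl// addr_ge0.
have Dk := HO_DC_dom k; have Dk1 := HO_DC_dom k.+1.
have Ux := DUf Dk; have Vx := DUg Dk.
set y := x k.+1 in Dk1 *.
have df : differentiable f y.
  by have [df _] : Ck Uf 1 f := Ck_le p0 Cf; apply: df; exact: DUf.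
have dg : differentiable g y.
  by have [dg _] : Ck Ug 1 g := Ck_le q0 Cg; apply: dg; exact: DUg.
have [xi xiE] : exists xi, forall e,
    dotp xi e = - dsmooth_model p q f g Mp Mq (x k) y e.
  apply: riesz_row => e; rewrite (@dsmooth_model_coord _ _ Uf Ug)// -sumrN.
  by apply: eq_bigr => a _; rewrite mulrN.
have [w wE] : exists w, forall e, dotp w e = Dd e f y - Dd e g y -
    dsmooth_model p q f g Mp Mq (x k) y e.
  apply: riesz_row => e; rewrite (@dsmooth_model_coord _ _ Uf Ug)//.
  rewrite (Dd_coord f e) (Dd_coord g e) -!sumrB.
  by apply: eq_bigr => a _; rewrite !mulrBr.
exists w; split => //.
- apply: (@objective_frechet _ _ f g psi y xi) => //.
  + by rewrite psi_dom.
  + by move=> z; rewrite xiE; exact: next_stationary.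
  + by move=> e; rewrite wE xiE; rewrite /Dd; ring.
have dk0 : 0 <= d k by exact: enorm_ge0.
apply: enorm_le_dual.
  apply: mulr_ge0; first exact: (addr_ge0 (addr_ge0 B10 B20) ler01).
  by apply: addr_ge0; apply: exprn_ge0.
move=> e; rewrite wE /dsmooth_model.
have := H1 _ _ _ _ _ _ e oUf DUf segment_closed_dom p0 (ltW Lpf0) Cf lipf Dk Dk1.
have := H2 _ _ _ _ _ _ e oUg DUg segment_closed_dom q0 (ltW Lqg0) Cg lipg Dk Dk1.
have := dreg_le Mp (x k) y e p0; have := dreg_le Mq (x k) y e q0.
rewrite -/(d k).
have e0 := enorm_ge0 e.
have P0 : 0 <= d k ^+ p * enorm e by rewrite mulr_ge0 ?exprn_ge0.
have Q0 : 0 <= d k ^+ q * enorm e by rewrite mulr_ge0 ?exprn_ge0.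
move: (dreg p _ _ _ _) (dreg q _ _ _ _) (Dd e f y) (Dd e g y)
  (dtaylor p _ _ _ _) (dtaylor q _ _ _ _) => r1 r2 a b ta tb.
have -> : (B1 + B2 + 1) * (d k ^+ p + d k ^+ q) * enorm e =
   C1 * Lpf * d k ^+ p * enorm e + C2 * Lqg * d k ^+ q * enorm e +
   `|Mp| / p`!%:R * d k ^+ p * enorm e + `|Mq| / q`!%:R * d k ^+ q * enorm e +
   ((B2 + 1) * (d k ^+ p * enorm e) + (B1 + 1) * (d k ^+ q * enorm e)).
  by rewrite /B1 /B2; ring.
have X0 : 0 <= (B2 + 1) * (d k ^+ p * enorm e) + (B1 + 1) * (d k ^+ q * enorm e).
  by rewrite addr_ge0// mulr_ge0// addr_ge0.
move: (C1 * Lpf * _ * _) (C2 * Lqg * _ * _) (`|Mp| / _ * _ * _) (`|Mq| / _ * _ * _)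
  ((B2 + 1) * _ + _) X0 => c1 c2 c3 c4 c5 c50.
rewrite !ler_norml => /andP[? ?] /andP[? ?] /andP[? ?] /andP[? ?].
by apply/andP; split; lra.
Qed.


Let cp := (Mp - Lpf) / p.+1`!%:R.
Let cq := (Mq - Lqg) / q.+1`!%:R.

Let cp0 : 0 < cp.
Proof. by have [H _ _ _] := xHO; rewrite divr_gt0 ?subr_gt0// ltr0n fact_gt0. Qed.

Let cq0 : 0 < cq.
Proof. by have [_ H _ _] := xHO; rewrite divr_gt0 ?subr_gt0// ltr0n fact_gt0. Qed.

Let d_ge0 k : 0 <= d k. Proof. exact: enorm_ge0. Qed.

Variables (Finf : R).
Hypotheses (Finf_le : forall k, Finf <= Fr k)
  (Finf_near : forall e : R, 0 < e -> exists N, forall k, (N <= k)%N -> Fr k < Finf + e).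

Lemma steps_vanish (e : R) : 0 < e ->
  exists N, forall k, (N <= k)%N -> enorm (x k.+1 - x k) < e.
Proof.
move=> e0; have ce : 0 < cp * e ^+ p.+1 by rewrite mulr_gt0// exprn_gt0.
have [N HN] := Finf_near ce; exists N => k Nk.
rewrite -(@ltr_pXn2r _ p.+1) ?nnegrE ?enorm_ge0 ?(ltW e0)//.
rewrite -(ltr_pM2l cp0).
have := objective_decrease k; rewrite -/cp -/cq /d.
have := HN k Nk; have := Finf_le k.+1.
have : 0 <= cq * d k ^+ q.+1 by rewrite mulr_ge0 ?(ltW cq0)// exprn_ge0.
rewrite /d; lra.
Qed.

Lemma limit_points_dom z : limit_points x z -> dom psi z.
Proof.
move=> xz; apply: dom_closed => B /nbhs_ballP[e /= e0 HB].
have [k _ xk] := (limit_pointsP x z).1 xz e 0%N e0.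
exists (x k); split; first exact: HO_DC_dom.
apply: HB; rewrite -ball_normE /= distrC.
by apply: le_lt_trans xk; exact: norm_le_enorm.
Qed.

Let near_limit z (P : 'rV[R]_n -> Prop) N : limit_points x z ->
  (\forall y \near z, P y) -> exists2 k, (N <= k)%N & P (x k).
Proof.
move=> xz /nbhs_ballP[e /= e0 HB].
have [k Nk xk] := (limit_pointsP x z).1 xz e N e0.
exists k => //; apply: HB; rewrite -ball_normE /= distrC.
by apply: le_lt_trans xk; exact: norm_le_enorm.
Qed.

Let cvg_near (phi : 'rV[R]_n -> R) (z : 'rV[R]_n) (l e : R) : phi @ z --> l -> 0 < e ->
  \forall y \near z, `|phi y - l| < e.
Proof.
by move=> /cvgrPdist_lt H /H; apply: filterS => y; rewrite distrC.
Qed.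

(* Lower semicontinuity gives [F z <= Finf]; the subgradient inequality for [psi] at
   [x k.+1], tested at [z], gives the converse although [psi] need not be continuous. *)
Lemma limit_value z : limit_points x z -> F z = Finf%:E.
Proof.
move=> xz; have Dz := limit_points_dom xz.
have Uz := DUf Dz; have Vz := DUg Dz.
have cf : f @ z --> f z by exact: (Ck_le (leq0n p) Cf).
have cg : g @ z --> g z by exact: (Ck_le (leq0n q) Cg).
rewrite (F_dom Dz); congr EFin; apply/eqP; rewrite eq_le; apply/andP; split.
  apply/ler_addgt0Pr => e e0; have e4 : 0 < e / 4 by rewrite divr_gt0.
  have [N HN] := Finf_near e4.
  have [|V Vz' HV] := psi_lsc (x := z) (a := fine (psi z) - e / 4).
    by rewrite [X in (_ < X)%E](psi_dom Dz) lte_fin; lra.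
  have [k Nk [Vk [H1 H2]]] := near_limit N xz
    (filterI Vz' (filterI (cvg_near cf e4) (cvg_near cg e4))).
  have := HV _ Vk; rewrite (psi_dom (HO_DC_dom k)) lte_fin.
  have := HN k Nk; rewrite /Fr; move: H1 H2; rewrite /= !ltr_norml.
  by move=> /andP[? ?] /andP[? ?]; lra.
apply/ler_addgt0Pr => e e0; have e8 : 0 < e / 8 by rewrite divr_gt0.
have [C C0 HC] := small_subgradient.
have [N HN] := steps_vanish ltr01.
(* Steps of length at most 1 give |w| <= 2C, so within [e'] of [z] the pairing of [w] with z -
   x_{k+1} is at most e/8. *)
pose e' := e / 8 / (2 * C).
have e'0 : 0 < e' by rewrite divr_gt0// mulr_gt0.
(* [N.+1] forces the index to be a successor, as the subgradients live at [x k.+1]. *)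
have [k Nk [[H1 H2] [[H3 H4] H5]]] := near_limit N.+1 xz
    (filterI (filterI (cvg_near cf e8) (cvg_near cg e8))
    (filterI (filterI (cvg_near (Dd_cvg0 oUf p0 Cf Uz) e8)
                      (cvg_near (Dd_cvg0 oUg q0 Cg Vz) e8)) (near_enorm_lt z e'0))).
case: k Nk H1 H2 H3 H4 H5 => // k Nk H1 H2 H3 H4 H5.
have [w [_ wE wC]] := HC k.
have := next_stationary k z; rewrite (psi_dom Dz) (psi_dom (HO_DC_dom k.+1)) -EFinD lee_fin.
have := wE (z - x k.+1); have := Finf_le k.+1; rewrite /Fr.
have wz : `|dotp w (z - x k.+1)| <= e / 8.
  apply: le_trans (dotp_le _ _) _.
  have dk1 : d k <= 1 by apply: ltW; exact: HN.
  have w2 : enorm w <= 2 * C.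
    apply: le_trans wC _; rewrite [leRHS]mulrC ler_pM2l//.
    by rewrite -[2]/(1 + 1) lerD// exprn_ile1.
  have -> : e / 8 = (2 * C) * e' by rewrite /e'; field; rewrite gt_eqF.
  by rewrite ler_pM ?enorm_ge0// enormBC ltW.
move: wz H1 H2 H3 H4; rewrite /= !subr0 ler_norml !ltr_norml.
move=> /andP[? ?] /andP[? ?] /andP[? ?] /andP[? ?] /andP[? ?]; lra.
Qed.

Lemma stationarity_bound k (C : R) w : frechet_subdiff F (x k.+1) w -> enorm w <= C ->
  (stat_measure F (x k.+1) <= C%:E)%E.
Proof.
move=> Hw wC; apply: (@le_trans _ _ (enorm w)%:E); last by rewrite lee_fin.
apply: ereal_inf_lbound; exists w; last by rewrite sub0r enormN.
by apply: frechet_limiting => //; rewrite F_dom//; exact: HO_DC_dom.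
Qed.

(** The points x_{k+1} with the subgradients of [small_subgradient] witness 0: the values converge
    to F(z) by [limit_value] and the subgradients vanish with the steps. *)
Lemma limit_stationary z : x @ \oo --> z -> limit_points x z ->
  limiting_subdiff F z 0.
Proof.
move=> xz lz; have Fz := limit_value lz; split; first by rewrite Fz.
have [C C0 /choice[w Hw]] := small_subgradient.
exists (fun k => x k.+1), w; split.
- by rewrite (cvg_shiftS x).
- have Fk k : F (x k) = (Fr k)%:E by rewrite (F_dom (HO_DC_dom k)).
  rewrite Fz; apply: cvg_EFin; first by apply: nearW => k; rewrite /= Fk.
  apply/cvgrPdist_lt => e e0; have [N HN] := Finf_near e0.
  exists N => // k /= Nk; rewrite Fk /= distrC ger0_norm ?subr_ge0 ?Finf_le//.
  by rewrite ltrBlDl HN// ltnW.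
- apply: enorm_cvgP => e e0; have C2 : 0 < 2 * C by rewrite mulr_gt0.
  have m0 : 0 < Num.min 1 (e / (2 * C)) by rewrite lt_min ltr01 divr_gt0.
  have [N HN] := steps_vanish m0; exists N => // k /= Nk.
  have [_ _ wC] := Hw k; rewrite subr0; apply: le_lt_trans wC _.
  have := HN k Nk; rewrite -/(d k) lt_min => /andP[/ltW dk1].
  rewrite ltr_pdivlMr// => dke.
  have dp := ler_wiXn2l (d_ge0 k) dk1 p0; have dq := ler_wiXn2l (d_ge0 k) dk1 q0.
  rewrite expr1 in dp; rewrite expr1 in dq.
  apply: le_lt_trans dke; rewrite [leLHS]mulrC mulrA ler_pM2r//.
  by rewrite mulr_natr mulr2n lerD.
- by move=> k; have [] := Hw k.
Qed.

Variable r : R.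
Hypotheses (r1 : 1 < r) (FKL : KL_condition F r (limit_points x))
  (Omega_compact : compact (limit_points x)) (Omega0 : limit_points x !=set0).

Lemma KL_descent : exists N c C, [/\ 0 < c, 0 < C,
  forall k, (N <= k)%N -> d k <= 1,
  forall k, (N <= k)%N -> c * d k ^+ (minn p q).+1 <= (Fr k - Finf) - (Fr k.+1 - Finf) &
  forall k, (N <= k)%N -> Fr k.+1 - Finf <= C * (d k ^+ minn p q) `^ r].
Proof.
have [||sig [del [eps [sig0 del0 eps0 KL]]]] :=
    @FKL Finf Omega_compact (limit_points_connected Omega_compact steps_vanish).
  by move=> z /limit_value; rewrite /dom /= => ->; rewrite ltry.
  exact: limit_value.
have [z0 Oz0] := Omega0.
(* With [B] the whole limit set the separation condition is immediate. *)
have [||N1 HN1] := limit_points_trap del0 Omega_compact _ steps_vanish.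
- by exists z0.
- by move=> z zl _.
have [N2 HN2] := steps_vanish ltr01.
have [N3 HN3] := Finf_near eps0.
have [B B0 HB] := small_subgradient.
have dmin k m : d k <= 1 -> (minn p q <= m)%N -> d k ^+ m <= d k ^+ minn p q.
  by move=> dk1; exact: ler_wiXn2l.
exists (maxn N1 (maxn N2 N3)), (Num.min cp cq), (sig * (2 * B) `^ r).
have r0 : 0 <= r by rewrite ltW// (lt_trans _ r1).
split.
- by rewrite lt_min cp0 cq0.
- by rewrite mulr_gt0// powR_gt0// mulr_gt0.
- by move=> k; rewrite !geq_max => /and3P[_ Nk _]; apply: ltW; exact: HN2.
- move=> k _; have := objective_decrease k; rewrite -/cp -/cq => H.
  rewrite opprB addrA subrK; apply: le_trans H.
  have Dp : 0 <= cp * d k ^+ p.+1 by rewrite mulr_ge0 ?(ltW cp0)// exprn_ge0.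
  have Dq : 0 <= cq * d k ^+ q.+1 by rewrite mulr_ge0 ?(ltW cq0)// exprn_ge0.
  have [pq|qp] := leqP p q.
    apply: le_trans (_ : cp * d k ^+ p.+1 <= _); last by rewrite lerDl.
    by rewrite ler_wpM2r ?exprn_ge0// ge_min lexx.
  apply: le_trans (_ : cq * d k ^+ q.+1 <= _); last by rewrite lerDr.
  by rewrite ler_wpM2r ?exprn_ge0// ge_min lexx orbT.
move=> k; rewrite !geq_max => /and3P[N1k N2k N3k].
have dk1 : d k <= 1 by apply: ltW; exact: HN2.
have Dk1 := HO_DC_dom k.+1.
have [w [Hw _ wC]] := HB k.
have {}wC : enorm w <= 2 * B * d k ^+ minn p q.
  apply: le_trans wC _; rewrite mulrAC -mulrA [leRHS]mulrC -mulrA mulrCA ler_pM2l//.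
  have := dmin _ _ dk1 (geq_minl p q); have := dmin _ _ dk1 (geq_minr p q); lra.
have S := stationarity_bound Hw wC.
have RHS0 : 0 <= sig * (2 * B) `^ r * (d k ^+ minn p q) `^ r.
  by rewrite !mulr_ge0 ?powR_ge0// ltW.
(* The KL inequality speaks only of values above [Finf]; at [Finf] the bound is trivial. *)
have [A0|A0] := leP (Fr k.+1 - Finf) 0; first exact: le_trans RHS0.
have Fk : F (x k.+1) = (Fr k.+1)%:E by rewrite (F_dom Dk1).
have [b Ob xb] := HN1 _ (leq_trans N1k (leqnSn k)).
have near_Omega : (Defs.edist (x k.+1) (limit_points x) <= del%:E)%E.
  apply: (@le_trans _ _ (enorm (x k.+1 - b))%:E); last by rewrite lee_fin ltW.
  by apply: ereal_inf_lbound; exists b.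
have := KL (x k.+1) near_Omega; rewrite Fk !lte_fin -EFinB.
rewrite -subr_gt0 A0 (HN3 _ (leq_trans N3k (leqnSn k))) => /(_ isT isT) H.
rewrite -lee_fin; apply: le_trans H _.
rewrite -mulrA EFinM lee_pmul2l ?lte_fin//.
have mono := @gt0_ler_poweR R r r0.
apply: (@le_trans _ _ (poweR (2 * B * d k ^+ minn p q)%:E r)).
  apply: mono S; rewrite in_itv /= ?leey ?andbT.
    by apply: le_ereal_inf_tmp => _ [v _ <-]; rewrite lee_fin enorm_ge0.
  by rewrite lee_fin !mulr_ge0 ?exprn_ge0// ltW.
rewrite poweR_EFin lee_fin powRM ?exprn_ge0//.
by rewrite mulr_ge0// ltW.
Qed.

(** The energy bounds the distance to any limit point, so its decay gives both convergence and the
    rate. The power rate is available for every r > 1; exponent 1 adds the geometric one. *)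
Theorem convergence_rate : exists xs, [/\ x @ \oo --> xs,
  limiting_subdiff F xs 0,
  sublinear_rate x xs &
  1 <= (r - 1) * (minn p q)%:R -> linear_rate x xs].
Proof.
have [N [c [C [c0 C0 d1 desc KL]]]] := KL_descent.
have s0 : (0 < minn p q)%N by rewrite leq_min p0 q0.
have [|E [K K0 HE]] := @KL_energy _ d (fun k => Fr k - Finf) r c C (minn p q) N
  d_ge0 _ r1 c0 C0 s0 d1 desc KL.
  by move=> k; rewrite subr_ge0.
have [xs xsl] := Omega0.
have Ecauchy k j : (N < k)%N -> enorm (x (k + j)%N - x k) <= E k - E (k + j)%N.
  move=> Nk; elim: j => [|j IH]; first by rewrite addn0 !subrr enorm0.
  have Nkj : (N < k + j)%N by rewrite (leq_trans Nk) ?leq_addr.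
  have [_ Ej _] := HE _ Nkj.
  rewrite addnS; apply: le_trans (enorm_dist (x (k + j)%N) _ _) _.
  by move: Ej IH; rewrite /d; lra.
(* So far [xs] is only a limit point: go through a later iterate close to [xs] and drop its
   nonnegative energy. *)
have xE k : (N < k)%N -> enorm (x k - xs) <= E k.
  move=> Nk; apply/ler_addgt0Pr => e e0.
  have [j kj xj] := (limit_pointsP x xs).1 xsl e k e0.
  have := Ecauchy k (j - k)%N Nk; rewrite subnKC// => H.
  have [E0 _ _] := HE j (leq_trans Nk kj).
  apply: le_trans (enorm_dist (x j) _ _) _.
  by move: H; rewrite enormBC; lra.
pose ka := Num.min 1 ((r - 1) * (minn p q)%:R).
have ka0 : 0 < ka by rewrite lt_min ltr01 mulr_gt0 ?subr_gt0// ltr0n.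
have E0 k : (N.+1 <= k)%N -> 0 <= E k by move=> /HE[].
have Edecr k : (N.+1 <= k)%N -> E k.+1 <= E k.
  move=> /HE[_ H _]; rewrite -subr_ge0; exact: le_trans (d_ge0 k) H.
have Estep k : (N.+1 <= k)%N -> E k.+1 <= K * (E k - E k.+1) `^ ka by move=> /HE[].
have [cs cs0 Hcs] := energy_sublinear_rate K0 ka0 E0 Edecr Estep.
have sub : sublinear_rate x xs.
  exists cs, ka; split => //; exists (N.+1.*2).+1 => // k /= Nk.
  apply: le_trans (Hcs k Nk); apply: xE.
  by apply: leq_trans (ltnW Nk); rewrite -addnn leq_addr.
have xcvg : x @ \oo --> xs.
  apply: enorm_cvgP => e e0.
  (* For k > M the bound cs k^(-ka) is below e/2. *)
  pose M := (2 * cs / e) `^ ka^-1.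
  near=> k.
  have kM : M < k%:R by near: k; exact: nbhs_infty_gtr.
  have Nk : (N.+1.*2 < k)%N by near: k; exact: nbhs_infty_gt.
  have Nk' : (N < k)%N by apply: leq_trans (ltnW Nk); rewrite -addnn leq_addr.
  apply: le_lt_trans (xE k Nk') _; apply: le_lt_trans (Hcs k Nk) _.
  have k0 : 0 < k%:R :> R by rewrite ltr0n; case: (k) Nk.
  have q0' : 0 < 2 * cs / e by rewrite divr_gt0// mulr_gt0.
  rewrite powRN ltr_pdivrMr ?powR_gt0//.
  have : M `^ ka < k%:R `^ ka by apply: gt0_ltr_powR; rewrite ?nnegrE ?powR_ge0// ltW.
  rewrite /M -powRrM mulVf ?gt_eqF// powRr1 ?(ltW q0')// ltr_pdivrMr// => H.
  by move: H; rewrite [_ * e]mulrC; lra.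
exists xs; split => //; first exact: limit_stationary.
move=> rs1; have ka1 : ka = 1 by apply/min_idPl.
have Estep1 k : (N.+1 <= k)%N -> E k.+1 <= K * (E k - E k.+1).
  move=> Nk; have := Estep k Nk; rewrite ka1 powRr1// subr_ge0; exact: Edecr.
have [cl [tau [cl0 tau01 Hcl]]] := energy_linear_rate K0 E0 Estep1.
exists cl, tau; split => //; exists N.+1 => // k /= Nk.
by apply: le_trans (Hcl k Nk); exact: xE.
Unshelve. all: by end_near.
Qed.

End HigherOrderDC.

Theorem theorem5 (R : realType) (n p q : nat)
    (f g : 'rV[R]_n -> R) (psi : 'rV[R]_n -> \bar R)
    (Lpf Lqg Mp Mq r : R) (x : nat -> 'rV[R]_n)
    (hp : (0 < p)%N) (hq : (0 < q)%N)
    (dom_closed : closed (dom psi))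
    (f_convex : convex_function (dom psi) f)
    (f_Cp : Ck_on (dom psi) p f)
    (Lpf_gt0 : 0 < Lpf)
    (f_lip : lipschitz_D (dom psi) p f Lpf)
    (g_convex : convex_function (dom psi) g)
    (g_Cq : Ck_on (dom psi) q g)
    (Lqg_gt0 : 0 < Lqg)
    (g_lip : lipschitz_D (dom psi) q g Lqg)
    (psi_proper : proper_efun psi)
    (psi_lsc : lower_semicontinuous psi)
    (psi_convex : econvex psi)
    (has_solution : exists2 xb : 'rV[R]_n, dom psi xb &
       forall y, (objective f psi g xb <= objective f psi g y)%E)
    (x_HO_DC : HO_DC p q f psi g Lpf Lqg Mp Mq x)
    (Omega_nonempty : limit_points x !=set0)
    (Omega_compact : compact (limit_points x))
    (r_gt1 : 1 < r)
    (F_KL : KL_condition (objective f psi g) r (limit_points x)) :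
  exists xs : 'rV[R]_n,
    [/\ x @ \oo --> xs,
        limiting_subdiff (objective f psi g) xs 0,
        (r - 1) * (minn p q)%:R < 1 -> sublinear_rate x xs &
        1 <= (r - 1) * (minn p q)%:R -> linear_rate x xs].
Proof.
have [Uf [oUf DUf] Cf] := f_Cp; have [Ug [oUg DUg] Cg] := g_Cq.
have [xb Dxb xbmin] := has_solution.
pose F := objective f psi g.
pose Fr k := f (x k) + fine (psi (x k)) - g (x k).
have psi_fin y : dom psi y -> psi y = (fine (psi y))%:E.
  move=> Dy; rewrite fineK//; have [psiN _] := psi_proper.
  by rewrite fin_numE psiN lt_eqF.
have Dx k : dom psi (x k) by apply: (HO_DC_dom psi_proper x_HO_DC).
have Fx k : F (x k) = (Fr k)%:E by rewrite /F /objective (psi_fin _ (Dx k)).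
have decr k : Fr k.+1 <= Fr k.
  rewrite -subr_ge0.
  have := objective_decrease hp hq oUf oUg DUf DUg Cf Cg f_lip g_lip psi_proper
    psi_convex x_HO_DC k.
  apply: le_trans; have [Mp0 Mq0 _ _] := x_HO_DC.
  by rewrite addr_ge0// mulr_ge0 ?exprn_ge0 ?enorm_ge0// divr_ge0// subr_ge0 ltW.
have bnd k : f xb + fine (psi xb) - g xb <= Fr k.
  by rewrite -lee_fin -Fx; have := xbmin (x k); rewrite {1}/objective (psi_fin _ Dxb).
(* The infimum of the values along the iterates, finite by the existence of a minimizer, is the
   constant F_* of the KL condition. *)
have [Finf [Finf_le Finf_near]] := nonincreasing_inf_limit bnd decr.
have [xs [xcv xstat sub lin]] := convergence_rate hp hq oUf oUg DUf DUg Cf Cg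
  Lpf_gt0 Lqg_gt0 f_lip g_lip psi_proper psi_lsc psi_convex dom_closed x_HO_DC
  Finf_le Finf_near r_gt1 F_KL Omega_compact Omega_nonempty.
by exists xs; split.
Qed.
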